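(* Let $\mathcal M$ be a family of matroids closed under formation of minors and of free products, and let $\mathbb K$ be a field of characteristic zero. Then the minor coalgebra $\mathbb K[\mathcal M]$ is cofree, and the set $\{Q_M : M\in\mathcal M \text{ irreducible}\}$ is a basis for the subspace of primitive elements of $\mathbb K[\mathcal M]$.
   Context: For a matroid $M$ on $S$ write $\rho_M$ for rank, $\rho(M)=\rho_M(S)$, $\nu_M(A)=|A|-\rho_M(A)$, $\lambda_M(A)=\rho(M)-\rho_M(A)$. For matroids $M$ on $S$ and $N$ on $T$ with $S\cap T=\emptyset$, the free product $M\mathbin{\Box} N$ is the matroid on $S\cup T$ whose independent sets are those $A$ with $A\cap S$ independent in $M$ and $\lambda_M(A\cap S)\geq\nu_N(A\cap T)$. Closure of $\mathcal M$ under minors / free products is up to isomorphism. A nonempty matroid is irreducible if every factorization of it as a free product contains it as a factor; every matroid factors as a free product of irreducibles, uniquely up to isomorphism. $\mathbb K[\mathcal M]$ is the free $\mathbb K$-module with basis the isomorphism classes of matroids in $\mathcal M$. The minor coalgebra structure is given by $\delta(M)=\sum_{A\subseteq S} M|A\otimes M/A$ and counit $\epsilon(M)=1$ if $M$ is the empty matroid and $0$ otherwise; the empty matroid $\emptyset$ is its unique group-like element, and $x$ is primitive if $\delta(x)=\emptyset\otimes x+x\otimes\emptyset$. The minor algebra is $\mathbb K[\mathcal M]$ with product $M\cdot N=\sum_L c^L_{M,N}L$, $c^L_{M,N}$ being the number of subsets $A$ of the ground set of $L$ with $L|A\cong M$, $L/A\cong N$. Define the pairing $\langle M,N\rangle=\delta_{M,N}$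 on basis elements. For $M\in\mathcal M$ with irreducible factors $M_1,\dots,M_k$ (in order), let $P_M=M_1\cdot\cdots\cdot M_k$ (product in the minor algebra). Under the hypotheses of the claim the elements $P_M$ ($M\in\mathcal M$) form a basis of $\mathbb K[\mathcal M]$; let $\{Q_M\}$ be the basis determined by $\langle Q_M,P_N\rangle=\delta_{M,N}$ for all $M,N\in\mathcal M$. *)

(* Defs.v *)
From mathcomp Require Import all_boot all_order all_algebra.
From Stdlib Require List.
From Stdlib Require Import ClassicalDescription.
Set Implicit Arguments.
Unset Strict Implicit.
Unset Printing Implicit Defensive.
Import GRing.Theory.
Local Open Scope ring_scope.

Record matroid := Mat { msz : nat; mind : {set {set 'I_msz}} }.

Definition matroidb (M : matroid) : bool :=
  [&& set0 \in mind M,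
      [forall A : {set 'I_(msz M)}, forall B : {set 'I_(msz M)},
          (A \in mind M) && (B \subset A) ==> (B \in mind M)] &
      [forall A : {set 'I_(msz M)}, forall B : {set 'I_(msz M)},
          [&& A \in mind M, B \in mind M & #|A| < #|B|]%N ==>
          [exists x in B :\: A, x |: A \in mind M]]].

Definition rk (M : matroid) (A : {set 'I_(msz M)}) : nat :=
  \max_(B in mind M | B \subset A) #|B|.

Definition isob (M N : matroid) : bool :=
  (msz M == msz N) &&
  [exists f : {ffun 'I_(msz M) -> 'I_(msz N)},
     injectiveb f && [forall A : {set 'I_(msz M)}, (A \in mind M) == (f @: A \in mind N)]].

Definition emptyM : matroid := @Mat 0 [set set0].

Definition emb n (A : {set 'I_n}) (i : 'I_#|A|) : 'I_n := enum_val i.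
Arguments emb {n} A i.

Definition restr (M : matroid) (A : {set 'I_(msz M)}) : matroid :=
  @Mat #|A| [set B : {set 'I_#|A|} | emb A @: B \in mind M].

Definition contr (M : matroid) (A : {set 'I_(msz M)}) : matroid :=
  @Mat #|~: A| [set B : {set 'I_#|~: A|} |
                 rk (emb (~: A) @: B :|: A) == (#|B| + rk A)%N].

Arguments restr : clear implicits.
Arguments contr : clear implicits.

Definition freeprod (M N : matroid) : matroid :=
  @Mat (msz M + msz N)
   [set A : {set 'I_(msz M + msz N)} |
     let AS := [set i : 'I_(msz M) | lshift (msz N) i \in A] in
     let AT := [set j : 'I_(msz N) | rshift (msz M) j \in A] in
     (AS \in mind M) &&
     (#|AT| - rk AT <= rk [set: 'I_(msz M)] - rk AS)%N].

Definition fprod_seq (s : seq matroid) : matroid := foldr freeprod emptyM s.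

Definition irreducible (M : matroid) : Prop :=
  (0 < msz M)%N /\
  forall s : seq matroid, (forall N, List.In N s -> matroidb N) ->
    isob M (fprod_seq s) -> exists N, List.In N s /\ isob N M.

Definition irrfact (N : matroid) (s : seq matroid) : Prop :=
  (forall Mi, List.In Mi s -> matroidb Mi /\ irreducible Mi) /\ isob N (fprod_seq s).

Definition isoclos (fam : matroid -> Prop) (M : matroid) : Prop :=
  exists N, fam N /\ isob N M.

Definition isrep (M : matroid) : bool :=
  [forall D : {set {set 'I_(msz M)}},
     isob (@Mat (msz M) D) M ==> (enum_rank (mind M) <= enum_rank D)%N].

Section KM.
Variable K : fieldType.
Variable F : matroid -> Prop.  (* the (isomorphism-closed) family *)

(* Elements of K[F] are modelled as iso-invariant functions on matroids,
   vanishing outside F, with support of bounded size: the coefficient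
   of each isomorphism class. *)
Definition KM (x : matroid -> K) : Prop :=
  (forall M N, isob M N -> x M = x N) /\
  (forall M, ~ F M -> x M = 0) /\
  (exists b, forall M, (b <= msz M)%N -> x M = 0).

(* Elements of K[F] (x) K[F] are functions on pairs of matroids. *)
Definition tens (u v : matroid -> K) : matroid -> matroid -> K :=
  fun N1 N2 => u N1 * v N2.

Definition bvec (M : matroid) : matroid -> K := fun N => (isob M N)%:R.

Definition clsum (k : nat) (g : matroid -> K) : K :=
  \sum_(D : {set {set 'I_k}} | isrep (@Mat k D)) g (@Mat k D).

(* coproduct  delta(L) = sum_A L|A (x) L/A, extended linearly *)
Definition delta (x : matroid -> K) : matroid -> matroid -> K :=
  fun N1 N2 => clsum (msz N1 + msz N2) (fun L =>
    x L * (#|[set A : {set 'I_(msz L)} |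
               isob (restr L A) N1 && isob (contr L A) N2]|)%:R).

Definition eps (x : matroid -> K) : K := x emptyM.

Definition mul (x y : matroid -> K) : matroid -> K :=
  fun L => if excluded_middle_informative (F L)
           then \sum_(A : {set 'I_(msz L)}) x (restr L A) * y (contr L A)
           else 0.

Definition Pvec (s : seq matroid) : matroid -> K :=
  foldr (fun M acc => mul (bvec M) acc) (bvec emptyM) s.

Definition pair_upto (b : nat) (x y : matroid -> K) : K :=
  \sum_(k < b) clsum k (fun L => x L * y L).

Definition pairing_is (x y : matroid -> K) (c : K) : Prop :=
  exists b, forall k, (b <= k)%N -> pair_upto k x y = c.

Definition dualQ (Q : matroid -> matroid -> K) : Prop :=
  (forall M, F M -> KM (Q M)) /\
  (forall M N s, F M -> F N -> irrfact N s ->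
     pairing_is (Q M) (Pvec s) (isob M N)%:R).

Definition lincomb (I : Type) (b : I -> matroid -> K) (l : seq (I * K)) : matroid -> K :=
  fun M => \sum_(p <- l) p.2 * b p.1 M.

Definition is_basis (I : Type) (J : I -> Prop) (P : (matroid -> K) -> Prop)
    (b : I -> matroid -> K) : Prop :=
  (forall i, J i -> P (b i)) /\
  (forall x, P x -> exists l : seq (I * K),
      (forall p, List.In p l -> J p.1) /\ forall M, x M = lincomb b l M) /\
  (forall l : seq (I * K), (forall p, List.In p l -> J p.1) -> List.NoDup (map fst l) ->
      (forall M, lincomb b l M = 0) -> forall p, List.In p l -> p.2 = 0).

Definition primitive (x : matroid -> K) : Prop :=
  KM x /\ forall N1 N2, delta x N1 N2 = tens (bvec emptyM) x N1 N2 + tens x (bvec emptyM) N1 N2.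

(* cofree: isomorphic as a coalgebra to the tensor coalgebra T^c(V) with
   deconcatenation coproduct, V having a basis indexed by X; i.e. K[F] has a
   basis (b_w) indexed by words w over X with
   delta b_w = sum_{w = uv} b_u (x) b_v  and  eps b_w = [w = nil]. *)
Definition cofree : Prop :=
  exists (X : Type) (b : seq X -> matroid -> K),
    is_basis (fun _ => True) KM b /\
    (forall w N1 N2, delta (b w) N1 N2 =
        \sum_(i < (size w).+1) tens (b (take i w)) (b (drop i w)) N1 N2) /\
    (forall w, eps (b w) = (size w == 0%N)%:R).

End KM.

Arguments KM : clear implicits.
Arguments dualQ : clear implicits.
Arguments primitive : clear implicits.
Arguments cofree : clear implicits.

(* Main.v *)
(** In rank terms, the subsets U with M = M|U [] M/U (free separators; [] is the free product)
    are those for which every X satisfying "X meets U in an independent set and |X| <= rk (X u U)" is independent. They are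
    closed under intersection, a matroid is irreducible iff it has no proper nonempty one, and two
    disjoint nonempty free separators force every dependent set to span both, so that exchanging an
    element of one with an element of the other is an automorphism. This yields unique
    factorization, hence the P_M are indexed by words in the irreducibles and P_u . P_v = P_uv by
    associativity of the minor algebra.

    Since M[]N is the freest matroid with restriction M and quotient N, P_w(L) <> 0 forces L to lie
    below the free product of w in the weak order, hence to have no more independent sets; in
    characteristic zero the diagonal coefficient, a positive integer, is nonzero. So the P_M form a
    triangular basis with a dual basis Q_M. As the coproduct is adjoint to the minor product, the
    coproduct of Q_w is the deconcatenation of w, and a primitive element pairs to zero with every
    P_M with M reducible or empty. *)

(* The test for a separator is the definition of the free product with its subtractions cleared. If
   the left part of [A] is independent, lambda >= nu says that |A| is at most rk(M) plus the rank in
   N of the right part; for M = L|U and N = L/U this sum is the rank of [A] joined with [U] in [L].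
   The obstacle is that iterated minors and free products live on different ordinals, so that even
   associativity of the minor algebra is a statement about isomorphisms. A minor is therefore
   described inside the ambient matroid, by an injection and a rank identity. These determine a
   matroid up to isomorphism, and most isomorphisms below come from this uniqueness. K[F] is in
   general infinite dimensional, but each P is homogeneous in the number of elements and there are
   finitely many classes of each size. Duality is thus the inversion of one finite triangular matrix
   per size. *)
Require Import Defs.
From HB Require Import structures.
From mathcomp Require Import all_boot all_order all_algebra.
From mathcomp Require Import perm zify.
From Stdlib Require List.
From Stdlib Require Import ClassicalEpsilon ClassicalDescription.
Set Implicit Arguments.
Unset Strict Implicit.
Unset Printing Implicit Defensive.
Import GRing.Theory.

(** * Rank, augmentation and submodularity in one matroid *)

Section Rank.
Variable M : matroid.
Implicit Types A B X Y : {set 'I_(msz M)}.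

Lemma rk_max A B : B \in mind M -> B \subset A -> #|B| <= rk A.
Proof. by move=> BM BA; apply: (@leq_bigmax_cond _ _ (fun B => #|B|)); rewrite BM. Qed.

Lemma rk_le A k : (forall B, B \in mind M -> B \subset A -> #|B| <= k) -> rk A <= k.
Proof. by move=> h; apply/bigmax_leqP=> B /andP[]; apply: h. Qed.

Lemma rk_card A : rk A <= #|A|.
Proof. by apply: rk_le => B _ /subset_leq_card. Qed.

Lemma rkS A B : A \subset B -> rk A <= rk B.
Proof. by move=> sAB; apply: rk_le => C CM CA; apply: rk_max => //; apply: subset_trans sAB. Qed.

Hypothesis matM : matroidb M.

Lemma ind0 : set0 \in mind M.
Proof. by case/and3P: matM. Qed.

Lemma indS A B : A \in mind M -> B \subset A -> B \in mind M.
Proof.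
case/and3P: matM => _ /forallP/(_ A)/forallP/(_ B)/implyP h _ AM BA.
by apply: h; rewrite AM.
Qed.

Lemma ind_aug A B : A \in mind M -> B \in mind M -> #|A| < #|B| ->
  exists x, [/\ x \in B, x \notin A & x |: A \in mind M].
Proof.
case/and3P: matM => _ _ /forallP/(_ A)/forallP/(_ B)/implyP h AM BM AB.
have /existsP[x /andP[]] := h (introT and3P (And3 AM BM AB)).
by rewrite inE => /andP[xA xB] xM; exists x.
Qed.

Lemma rk_basis A : exists B, [/\ B \in mind M, B \subset A & #|B| = rk A].
Proof.
have h0 : (set0 \in mind M) && (set0 \subset A) by rewrite ind0 sub0set.
case: (@arg_maxnP _ set0 [pred B | (B \in mind M) && (B \subset A)] (fun B => #|B|) h0).
move=> B /andP[BM BA] Bmax; exists B; split=> //; apply/eqP; rewrite eqn_leq rk_max //=.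
by apply: rk_le => C CM CA; apply: Bmax; rewrite /= CM CA.
Qed.

Lemma ind_rk A : (A \in mind M) = (rk A == #|A|).
Proof.
apply/idP/eqP => [AM|e]; first by apply/eqP; rewrite eqn_leq rk_card rk_max.
have [B [BM BA cB]] := rk_basis A.
suff -> : A = B by [].
by apply/eqP; rewrite eq_sym eqEcard BA cB e /=.
Qed.

Lemma rk_ind A : A \in mind M -> rk A = #|A|.
Proof. by rewrite ind_rk => /eqP. Qed.

Lemma ind_extend A X : A \in mind M -> A \subset X ->
  exists B, [/\ A \subset B, B \subset X, B \in mind M & #|B| = rk X].
Proof.
move=> AM AX.
have h0 : [&& A \in mind M, A \subset X & A \subset A] by rewrite AM AX subxx.
case: (@arg_maxnP _ A [pred B | [&& B \in mind M, B \subset X & A \subset B]]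
         (fun B => #|B|) h0) => B /and3P[BM BX AB] Bmax.
exists B; split=> //; apply/eqP; rewrite eqn_leq rk_max //= leqNgt; apply/negP=> lt.
have [C [CM CX cC]] := rk_basis X.
have [x [xC xB xBM]] : exists x, [/\ x \in C, x \notin B & x |: B \in mind M].
  by apply: ind_aug => //; rewrite cC.
have := Bmax (x |: B); rewrite /= xBM subUset sub1set (subsetP CX) // BX.
rewrite (subset_trans AB) ?subsetUr // cardsU1 xB => /(_ isT) /=.
by rewrite add1n ltnn.
Qed.

Lemma rk_submod A B : rk (A :|: B) + rk (A :&: B) <= rk A + rk B.
Proof.
have [I [IM IAB cI]] := rk_basis (A :&: B).
have IU : I \subset A :|: B.
  by apply: subset_trans IAB _; apply: subset_trans (subsetIl _ _) (subsetUl _ _).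
have [J [IJ JAB JM cJ]] := ind_extend IM IU.
rewrite -cI -cJ.
have hA : #|J :&: A| <= rk A by apply: rk_max (subsetIr _ _); apply: indS JM (subsetIl _ _).
have hB : #|J :&: B| <= rk B by apply: rk_max (subsetIr _ _); apply: indS JM (subsetIl _ _).
apply: leq_trans (leq_add hA hB).
rewrite -(cardsUI (J :&: A)) -setIUr (setIidPl JAB) leq_add2l; apply: subset_leq_card.
by rewrite !subsetI IJ /= -subsetI.
Qed.

Lemma rkU_card A B : rk (A :|: B) <= rk A + #|B|.
Proof. by have := rk_submod A B; have := rk_card B; lia. Qed.

(** Monotonicity of closure, the form in which the span of a circuit is passed on to every dependent
    set containing it ([dep_span]). *)
Lemma span_mono A B X : A \subset B -> rk (A :|: X) = rk A -> rk (B :|: X) = rk B.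
Proof.
move=> AB e; have := rk_submod B (A :|: X).
rewrite setUA (setUidPl AB) e.
have : rk A <= rk (B :&: (A :|: X)) by apply: rkS; rewrite subsetI AB subsetUl.
have : rk B <= rk (B :|: X) by apply: rkS; apply: subsetUl.
by lia.
Qed.

Lemma rkD_card A B : rk B <= rk A + #|B :\: A|.
Proof.
have := rkU_card A (B :\: A); apply: leq_trans; apply: rkS.
by apply/subsetP=> x; rewrite !inE; case: (x \in A).
Qed.

Lemma rk_aug A B : rk A < rk B -> exists x, [/\ x \in B, x \notin A & rk A < rk (x |: A)].
Proof.
move=> lt.
have [I [IM IA cI]] := rk_basis A; have [J [JM JB cJ]] := rk_basis B.
have [x [xJ xI xIM]] : exists x, [/\ x \in J, x \notin I & x |: I \in mind M].
  by apply: ind_aug => //; rewrite cI cJ.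
have le : rk A < rk (x |: A).
  rewrite -cI; have -> : #|I|.+1 = #|x |: I| by rewrite cardsU1 xI.
  by apply: rk_max => //; apply: setUS.
exists x; split=> //; first exact: (subsetP JB).
by apply/negP=> xA; move: le; rewrite (setUidPr _) ?sub1set // ltnn.
Qed.

End Rank.

(** * Injections, isomorphisms and copies of minors *)

Section FinSets.
Variables (S T : finType) (f : S -> T).
Hypothesis f_inj : injective f.

Lemma imset_preim (B : {set T}) : B \subset f @: setT -> f @: (f @^-1: B) = B.
Proof.
move=> BT; apply/setP=> y; apply/imsetP/idP => [[x]|yB]; first by rewrite inE => h ->.
by have /imsetP[x _ e] := subsetP BT y yB; exists x => //; rewrite inE -e.
Qed.

Lemma preim_imset (A : {set S}) : f @^-1: (f @: A) = A.
Proof. by apply/setP=> x; rewrite inE mem_imset. Qed.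

Lemma imsetDinj (A B : {set S}) : f @: (A :\: B) = f @: A :\: f @: B.
Proof.
apply/setP=> y; apply/imsetP/setDP => [[x /setDP[xA xB] ->]|[/imsetP[x xA ->]]].
  by rewrite !mem_imset.
by rewrite mem_imset // => xB; exists x => //; rewrite inE xB xA.
Qed.

End FinSets.

(* [N] is a copy of the minor [(L|V)/U], placed in [L] by [f]. *)
Definition minor_via (N L : matroid) (U V : {set 'I_(msz L)}) (f : 'I_(msz N) -> 'I_(msz L)) :=
  [/\ injective f, f @: setT = V :\: U &
      forall B : {set 'I_(msz N)}, rk B + rk U = rk (f @: B :|: U)].

Lemma isobP M N : reflect (exists f : 'I_(msz M) -> 'I_(msz N),
    [/\ msz M = msz N, injective f & forall A, (A \in mind M) = (f @: A \in mind N)])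
  (isob M N).
Proof.
apply: (iffP andP) => [[/eqP e /existsP[f /andP[/injectiveP fi /forallP h]]]|[f [e fi h]]].
  by exists f; split=> // A; apply/eqP.
split; first exact/eqP.
apply/existsP; exists (finfun f); apply: (introT andP); split.
  by apply/injectiveP=> x y; rewrite !ffunE; apply: fi.
apply/forallP=> A; have -> : finfun f @: A = f @: A by apply: eq_imset => x; rewrite ffunE.
by rewrite h eqxx.
Qed.

Lemma inj_full m n (f : 'I_m -> 'I_n) : m = n -> injective f -> f @: setT = setT.
Proof.
move=> e fi; apply/eqP; rewrite eqEcard subsetT /= card_imset // !cardsT !card_ord.
by rewrite e.
Qed.

Lemma isob_refl M : isob M M.
Proof. by apply/isobP; exists id; split=> // A; rewrite imset_id. Qed.

Lemma isob_trans M N L : isob M N -> isob N L -> isob M L.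
Proof.
move=> /isobP[f [e fi h]] /isobP[g [e' gi h']]; apply/isobP; exists (g \o f).
split; [by rewrite e | exact: inj_comp |] => A.
by rewrite h h' (imset_comp g f).
Qed.

Lemma isob_sym M N : isob M N = isob N M.
Proof.
have h M' N' : isob M' N' -> isob N' M'; last by apply/idP/idP; apply: h.
move: M' N' => {}M {}N.
case/isobP=> f [e fi h].
have im y : y \in codom f by have := in_setT y; rewrite -(inj_full e fi) => /imsetP[x _ ->]; apply: codom_f.
apply/isobP; exists (fun y => iinv (im y)); split=> // [x y|A'].
  by move=> exy; rewrite -(f_iinv (im x)) -(f_iinv (im y)) exy.
rewrite h -(imset_comp f); have -> : (f \o (fun y => iinv (im y))) @: A' = id @: A'.
  by apply: eq_imset => x /=; rewrite f_iinv.
by rewrite imset_id.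
Qed.

Lemma isob_msz M N : isob M N -> msz M = msz N.
Proof. by case/isobP=> f []. Qed.

Lemma isob_minor M N : isob M N -> exists f, @minor_via M N set0 setT f.
Proof.
case/isobP=> f [e fi h]; exists f; split=> //; first by rewrite setD0 inj_full.
move=> B; rewrite setU0.
have -> : rk (set0 : {set 'I_(msz N)}) = 0.
  by apply/eqP; rewrite -leqn0; apply: leq_trans (rk_card _) _; rewrite cards0.
rewrite addn0; apply/eqP; rewrite eqn_leq; apply/andP; split; apply: rk_le => C CM CB.
  by rewrite -(card_imset _ fi) rk_max -?h // imsetS.
have CE : f @: (f @^-1: C) = C by apply: imset_preim; rewrite (inj_full e fi) subsetT.
by rewrite -CE card_imset // rk_max ?h ?CE // -(preim_imset fi B) preimsetS.
Qed.

Lemma isob_rk M N (f : 'I_(msz M) -> 'I_(msz N)) : matroidb M -> matroidb N ->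
  msz M = msz N -> injective f -> (forall A, rk A = rk (f @: A)) -> isob M N.
Proof.
move=> mM mN e fi h; apply/isobP; exists f; split=> // A.
by rewrite !ind_rk // h card_imset.
Qed.

Lemma isob_matroid M N : isob M N -> matroidb M -> matroidb N.
Proof.
rewrite isob_sym => /isobP[f [e fi h]] mM; apply/and3P; split.
- by rewrite h imset0 ind0.
- apply/forallP=> A; apply/forallP=> B; apply/implyP; rewrite !h => /andP[AM BA].
  by apply: indS AM _ => //; apply: imsetS.
apply/forallP=> A; apply/forallP=> B; apply/implyP; rewrite !h => /and3P[AM BM lt].
have [|_ [/imsetP[x xB ->]]] := ind_aug mM AM BM; first by rewrite !card_imset.
rewrite mem_imset // => xA xM; apply/existsP; exists x; rewrite inE xA xB h.
by rewrite imsetU1.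
Qed.

Lemma minor_via_card N L U V f : @minor_via N L U V f -> msz N = #|V :\: U|.
Proof. by case=> fi <- _; rewrite card_imset // cardsT card_ord. Qed.

(** The image and the rank identity fix the rank function of a copy, and in a matroid the rank
    decides independence. *)
Lemma minor_via_uniq N N' L U V f f' : matroidb N -> matroidb N' ->
  @minor_via N L U V f -> @minor_via N' L U V f' -> isob N N'.
Proof.
move=> mN mN' v v'; have := minor_via_card v; rewrite -(minor_via_card v') => e.
case: v v' => fi fT fr [fi' fT' fr'].
have im x : f x \in codom f'.
  have : f x \in f @: setT by apply: imset_f.
  by rewrite fT -fT' => /imsetP[y _ ->]; apply: codom_f.
pose h x := iinv (im x).
have hE x : f' (h x) = f x by apply: f_iinv.
apply: (@isob_rk _ _ h) => // [x y exy|A]; first by apply: fi; rewrite -!hE exy.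
apply/eqP; rewrite -(eqn_add2r (rk U)) fr fr' -(imset_comp f'); apply/eqP; congr (rk (_ :|: _)).
by apply: eq_imset => x /=; rewrite hE.
Qed.

(** A minor of a minor is a minor: the two rank identities telescope, the rank of [A] in [N]
    cancelling. *)
Lemma minor_via_comp N' N L U V A B f g : @minor_via N L U V f -> @minor_via N' N A B g ->
  @minor_via N' L (U :|: f @: A) (U :|: f @: B) (f \o g).
Proof.
case=> fi fT fr [gi gT gr]; split; first exact: inj_comp.
  rewrite (imset_comp f g) gT imsetDinj //; apply/setP=> y; rewrite !inE.
  case yU: (y \in U) => //=; apply/negP=> /andP[_ /imsetP[x _ ex]].
  have : y \in f @: setT by rewrite ex imset_f.
  by rewrite fT inE yU.
move=> C; have e1 : f @: (g @: C :|: A) :|: U = (f \o g) @: C :|: (U :|: f @: A).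
  by rewrite imsetU (imset_comp f g) -setUA [f @: A :|: U]setUC.
have := fr (g @: C :|: A); rewrite e1 => <-.
by rewrite [U :|: _]setUC -fr addnA gr.
Qed.

Lemma minor_via_eq N L U V U' V' f f' : U = U' -> V = V' -> f =1 f' ->
  @minor_via N L U V f -> @minor_via N L U' V' f'.
Proof.
move=> <- <- e [fi fT fr]; have ei (X : {set 'I_(msz N)}) : f' @: X = f @: X by apply: eq_imset => x; rewrite e.
split=> [x y|//|B]; first by rewrite -!e; apply: fi.
  by rewrite ei.
by rewrite ei.
Qed.

Lemma emb_inj n (A : {set 'I_n}) : injective (emb A).
Proof. exact: enum_val_inj. Qed.

Lemma emb_full n (A : {set 'I_n}) : emb A @: setT = A.
Proof.
apply/setP=> x; apply/imsetP/idP => [[i _ ->]|xA]; first exact: enum_valP.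
by exists (enum_rank_in xA x) => //; rewrite /emb enum_rankK_in.
Qed.

Lemma emb_sub n (A : {set 'I_n}) (B : {set 'I_#|A|}) : emb A @: B \subset A.
Proof. by apply/subsetP=> _ /imsetP[i _ ->]; apply: enum_valP. Qed.

Lemma rk_set0 M : rk (set0 : {set 'I_(msz M)}) = 0.
Proof. by apply/eqP; rewrite -leqn0; apply: leq_trans (rk_card _) _; rewrite cards0. Qed.

Lemma restr_via M A : @minor_via (restr M A) M set0 A (emb A).
Proof.
split; [exact: emb_inj | by rewrite setD0 emb_full | move=> B].
rewrite setU0 rk_set0 addn0; apply/eqP; rewrite eqn_leq.
apply/andP; split; apply: rk_le => C CM CB.
  by rewrite -(card_imset _ (@emb_inj _ A)) rk_max ?imsetS //; rewrite inE in CM.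
have CE : emb A @: (emb A @^-1: C) = C.
  by apply: imset_preim; rewrite emb_full; apply: subset_trans CB (emb_sub _).
rewrite -CE card_imset; last exact: emb_inj.
apply: rk_max; first by rewrite inE CE.
by rewrite -(preim_imset (@emb_inj _ A) B) preimsetS.
Qed.

Lemma contr_via M A : matroidb M -> @minor_via (contr M A) M A setT (emb (~: A)).
Proof.
move=> mM; split; [exact: emb_inj | by rewrite setTD emb_full | move=> B].
have ei := @emb_inj _ (~: A).
apply/eqP; rewrite eqn_leq; apply/andP; split.
  rewrite addnC -leq_subRL; last by apply: rkS; apply: subsetUr.
  apply: rk_le => C; rewrite inE => /eqP CM CB.
  rewrite leq_subRL; last by apply: rkS; apply: subsetUr.
  by rewrite addnC -CM; apply: rkS; apply: setSU; apply: imsetS.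
(* For the other inequality a basis of [A] is extended to a basis [J] of the union; [J :\: A] is
   then independent in the contraction and large enough. *)
have [I [IM IA cI]] := rk_basis mM A.
have [|J [IJ JB JM cJ]] := @ind_extend _ mM I (emb (~: A) @: B :|: A) IM.
  by apply: subset_trans IA (subsetUr _ _).
rewrite -cJ; pose C := emb (~: A) @^-1: J.
have CE : emb (~: A) @: C = J :\: A.
  apply/setP=> x; apply/imsetP/setDP => [[y]|[xJ xA]].
    by rewrite inE => yJ ->; split=> //; have := enum_valP y; rewrite inE.
  have : x \in emb (~: A) @: setT by rewrite emb_full inE.
  by case/imsetP=> y _ e; exists y => //; rewrite inE -e.
have cC : #|C| = #|J :\: A| by rewrite -CE card_imset.
have leA : #|J :&: A| <= rk A by apply: rk_max (subsetIr _ _); apply: (indS mM JM); apply: subsetIl.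
rewrite -(cardsID A J) addnC -cC; apply: leq_add => //; apply: rk_max.
  rewrite inE CE eqn_leq; apply/andP; split.
    by rewrite setUC addnC cC; apply: rkU_card.
  rewrite cC -cI; apply: leq_trans (_ : #|J| <= _); last first.
    by rewrite -(rk_ind mM JM); apply: rkS; rewrite setDE setUC; apply/subsetP=> x; rewrite !inE; case: (x \in A); rewrite ?andbT.
  rewrite -(cardsID A J) addnC leq_add2r; apply: subset_leq_card; by rewrite subsetI IJ IA.
rewrite -(preim_imset ei B) /C.
apply/subsetP=> y; rewrite !inE => yJ; have := subsetP JB _ yJ; rewrite inE => /orP[//|].
by have := enum_valP y; rewrite inE /emb => /negbTE->.
Qed.

(* Elaboration leaves [reverse_coercion] markers that hide equal atoms from [lia]. *)
Ltac slia := unfold reverse_coercion in *; simpl Finite.sort in *; simpl msz in *; lia.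

(** * The free product is a matroid *)

Notation lsh M N := (@lshift (msz M) (msz N)).
Notation rsh M N := (@rshift (msz M) (msz N)).

Section FreeProduct.
Variables M N : matroid.
Local Notation L := (freeprod M N).
Definition lpart (A : {set 'I_(msz M + msz N)}) : {set 'I_(msz M)} := lsh M N @^-1: A.
Implicit Type A : {set 'I_(msz M + msz N)}.
Definition rpart (A : {set 'I_(msz M + msz N)}) : {set 'I_(msz N)} := rsh M N @^-1: A.

Lemma split_imset (T : finType) (h : 'I_(msz M + msz N) -> T) (A : {set _}) :
  h @: A = (h \o lsh M N) @: lpart A :|: (h \o rsh M N) @: rpart A.
Proof.
apply/setP=> y; apply/imsetP/setUP => [[x xA ->]|].
  case: (splitP x) => i ei.
    have ex : x = lsh M N i by apply/val_inj.
    by left; apply/imsetP; exists i; rewrite ?inE -?ex //= -ex.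
  have ex : x = rsh M N i by apply/val_inj.
  by right; apply/imsetP; exists i; rewrite ?inE -?ex //= -ex.
by case=> /imsetP[i iA ->]; move: iA; rewrite inE => iA; [exists (lsh M N i)|exists (rsh M N i)].
Qed.

Lemma card_split A : #|A| = #|lpart A| + #|rpart A|.
Proof.
rewrite -[A in LHS]imset_id split_imset cardsU.
rewrite !card_imset; [|exact: rshift_inj|exact: lshift_inj].
suff -> : (id \o lsh M N) @: lpart A :&: (id \o rsh M N) @: rpart A = set0.
  by rewrite cards0 subn0.
apply/setP=> x; rewrite !inE; apply/negP=> /andP[/imsetP[i _ ->] /imsetP[j _ /eqP]].
by rewrite /= eq_lrshift.
Qed.

(** Both differences in the definition are truncated, but neither truncation occurs when the left
    part is independent, so they can be cleared into this additive bound. *)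
Lemma ind_freeprod : matroidb M -> forall A : {set 'I_(msz M + msz N)},
  (A \in mind L) = (lpart A \in mind M) && (#|A| <= rk [set: 'I_(msz M)] + rk (rpart A)).
Proof.
move=> mM A; have -> : (A \in mind L) = (lpart A \in mind M) &&
    (#|rpart A| - rk (rpart A) <= rk [set: 'I_(msz M)] - rk (lpart A)) by rewrite inE.
case: (boolP (lpart A \in mind M)) => //= AM.
rewrite card_split (rk_ind mM AM).
have := rk_card (rpart A); have := rkS (subsetT (lpart A)); rewrite (rk_ind mM AM).
by move=> *; apply/idP/idP; slia.
Qed.

Hypotheses (mM : matroidb M) (mN : matroidb N).

Lemma lpartU1l i A : lpart (lsh M N i |: A) = i |: lpart A.
Proof. by apply/setP=> j; rewrite !inE eq_lshift. Qed.
Lemma rpartU1l i A : rpart (lsh M N i |: A) = rpart A.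
Proof. by apply/setP=> j; rewrite !inE eq_rlshift. Qed.
Lemma lpartU1r i A : lpart (rsh M N i |: A) = lpart A.
Proof. by apply/setP=> j; rewrite !inE eq_lrshift. Qed.
Lemma rpartU1r i A : rpart (rsh M N i |: A) = i |: rpart A.
Proof. by apply/setP=> j; rewrite !inE eq_rshift. Qed.

Lemma freeprod_matroid : matroidb L.
Proof.
apply/and3P; split.
- by rewrite ind_freeprod // /lpart preimset0 ind0 // cards0.
- apply/forallP=> A; apply/forallP=> B; apply/implyP=> /andP[].
  rewrite !ind_freeprod // => /andP[AM cA] BA.
  have lBA : lpart B \subset lpart A by apply: preimsetS.
  have rBA : rpart B \subset rpart A by apply: preimsetS.
  rewrite (indS mM AM) //=.
  have h1 := subset_leq_card lBA; have h2 := rkD_card mN (rpart B) (rpart A).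
  have h3 := cardsD (rpart A) (rpart B); rewrite (setIidPr rBA) in h3.
  have h4 := subset_leq_card rBA; move: cA; rewrite !card_split; slia.
apply/forallP=> A; apply/forallP=> B; apply/implyP=> /and3P[].
rewrite !ind_freeprod // => /andP[AM cA] /andP[BM cB] lt.
(* Augmentation. If the bound on [A] is tight, [B] has the larger right rank, and an element raising
   the right rank raises both sides of the bound. If there is slack, any new element that keeps the
   left part independent will do: either [B] has more elements on the left and [M] augments, or it
   has more on the right. *)
have [eA|neA] := leqP (rk [set: 'I_(msz M)] + rk (rpart A)) #|A|.
  have [|y [yB yA ry]] := @rk_aug _ mN (rpart A) (rpart B).
    by move: cA cB lt eA; slia.
  move: (yB) (yA); rewrite !inE => yB' yA'; apply/existsP.
  exists (rsh M N y); rewrite inE yB' yA' ind_freeprod // lpartU1r AM rpartU1r cardsU1 yA' /=.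
  by move: cA ry; slia.
have [lS|lS] := ltnP #|lpart A| #|lpart B|.
  have [x [xB xA xM]] := ind_aug mM AM BM lS.
  move: (xB) (xA); rewrite !inE => xB' xA'; apply/existsP.
  exists (lsh M N x); rewrite inE xB' xA' ind_freeprod // lpartU1l xM rpartU1l cardsU1 xA' /=.
  by move: neA; slia.
have : ~~ (rpart B \subset rpart A).
  apply/negP=> /subset_leq_card; move: lt lS; rewrite !card_split; slia.
case/subsetPn=> y yB yA; move: (yB) (yA); rewrite !inE => yB' yA'; apply/existsP.
exists (rsh M N y); rewrite inE yB' yA' ind_freeprod // lpartU1r AM rpartU1r cardsU1 yA' /=.
have : rk (rpart A) <= rk (y |: rpart A) by apply: rkS; apply: subsetUr.
by move: neA; slia.
Qed.

End FreeProduct.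

(** * Free separators and the decompositions they give *)

(* A subset [U] such that [L] is the free product of [L|U] and [L/U]. *)
Definition free_sep L (U : {set 'I_(msz L)}) := forall X : {set 'I_(msz L)},
  X :&: U \in mind L -> #|X| <= rk (X :|: U) -> X \in mind L.

Section Glue.
Variables (L M N : matroid) (U : {set 'I_(msz L)}).
Variables (f : 'I_(msz M) -> 'I_(msz L)) (g : 'I_(msz N) -> 'I_(msz L)).
Hypotheses (mL : matroidb L) (mM : matroidb M).
Hypotheses (vM : @minor_via M L set0 U f) (vN : @minor_via N L U setT g).

Definition glue (i : 'I_(msz M + msz N)) : 'I_(msz L) :=
  match split i with inl j => f j | inr k => g k end.

Lemma glueL i : glue (lshift _ i) = f i.
Proof. by rewrite /glue (unsplitK (inl i)). Qed.
Lemma glueR i : glue (rshift _ i) = g i.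
Proof. by rewrite /glue (unsplitK (inr i)). Qed.

Lemma glue_l_in i : f i \in U.
Proof. by case: vM => _ fT _; rewrite setD0 in fT; rewrite -fT imset_f. Qed.
Lemma glue_r_notin i : g i \notin U.
Proof.
by case: vN => _ gT _; have : g i \in g @: setT; [rewrite imset_f | rewrite gT inE => /andP[]].
Qed.

Lemma glue_inj : injective glue.
Proof.
case: vM vN => fi _ _ [gi _ _] x y; case: (splitP x) => i ei; case: (splitP y) => j ej.
- have -> : x = lshift _ i by apply/val_inj.
  have -> : y = lshift _ j by apply/val_inj.
  by rewrite !glueL => /fi->.
- have -> : x = lshift _ i by apply/val_inj.
  have -> : y = rshift _ j by apply/val_inj.
  by rewrite glueL glueR => e; have := glue_r_notin j; rewrite -e glue_l_in.
- have -> : x = rshift _ i by apply/val_inj.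
  have -> : y = lshift _ j by apply/val_inj.
  by rewrite glueL glueR => e; have := glue_r_notin i; rewrite e glue_l_in.
- have -> : x = rshift _ i by apply/val_inj.
  have -> : y = rshift _ j by apply/val_inj.
  by rewrite !glueR => /gi->.
Qed.

Lemma glue_msz : msz M + msz N = msz L.
Proof.
rewrite (minor_via_card vM) (minor_via_card vN) setD0 setTD.
by rewrite cardsC card_ord.
Qed.

Lemma glue_imset (A : {set 'I_(msz M + msz N)}) :
  glue @: A = f @: (lsh M N @^-1: A) :|: g @: (rsh M N @^-1: A).
Proof.
rewrite split_imset /lpart /rpart; congr (_ :|: _); apply: eq_imset => i /=; [exact: glueL|exact: glueR].
Qed.

(** The rank identities of the two copies translate the bound: the rank of [M] is that of [U], and
    adding it to a rank in [N] gives the rank of a union with [U]. *)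
Lemma glue_ind (A : {set 'I_(msz M + msz N)}) :
  (A \in mind (freeprod M N)) =
  (glue @: A :&: U \in mind L) && (#|glue @: A| <= rk (glue @: A :|: U)).
Proof.
rewrite ind_freeprod // /lpart /rpart card_imset; last exact: glue_inj.
set A1 := _ @^-1: A; set A2 := rsh M N @^-1: A.
have fU (B : {set 'I_(msz M)}) : f @: B \subset U by apply/subsetP=> _ /imsetP[i _ ->]; apply: glue_l_in.
have e1 : glue @: A :&: U = f @: A1.
  rewrite glue_imset setIUl (setIidPl (fU _)); apply/setUidPl/subsetP=> x.
  by rewrite inE => /andP[/imsetP[i _ ->]]; rewrite (negbTE (glue_r_notin i)).
have e2 : glue @: A :|: U = g @: A2 :|: U.
  by rewrite glue_imset setUAC (setUidPr (fU _)) setUC.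
rewrite e1 e2; case: vM vN => fi fT fr [gi gT gr].
have fr' (B : {set 'I_(msz M)}) : rk B = rk (f @: B) by have := fr B; rewrite rk_set0 addn0 setU0.
rewrite !ind_rk // fr' card_imset // -gr fr' fT setD0 [rk U + _]addnC.
by [].
Qed.

(** An independent [X] always passes the test, since [#|X| = rk X <= rk (X :|: U)]. The property
    [free_sep] is the converse, which is what [glue_isob] adds. *)
Lemma glue_weak (A : {set 'I_(msz M + msz N)}) :
  glue @: A \in mind L -> A \in mind (freeprod M N).
Proof.
move=> AL; rewrite glue_ind (indS mL AL (subsetIl _ _)) /=.
by rewrite -(rk_ind mL AL) rkS ?subsetUl.
Qed.

Lemma glue_isob : free_sep U -> isob (freeprod M N) L.
Proof.
move=> fs; apply/isobP; exists glue; split; [exact: glue_msz | exact: glue_inj |] => A.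
apply/idP/idP; last exact: glue_weak.
by rewrite glue_ind => /andP[h1 h2]; apply: fs.
Qed.

End Glue.

Section Factors.
Variables M N : matroid.
Hypotheses (mM : matroidb M) (mN : matroidb N).
Local Notation L := (freeprod M N).
Let U : {set 'I_(msz L)} := lsh M N @: setT.
Let mL : matroidb L := freeprod_matroid mM mN.

Let lpS (A : {set 'I_(msz M)}) : lsh M N @^-1: (lsh M N @: A) = A.
Proof. by apply: preim_imset; apply: lshift_inj. Qed.
Let rpS (A : {set 'I_(msz N)}) : rsh M N @^-1: (rsh M N @: A) = A.
Proof. by apply: preim_imset; apply: rshift_inj. Qed.
Let rpl (A : {set 'I_(msz M)}) : rsh M N @^-1: (lsh M N @: A) = set0.
Proof. by apply/setP=> i; rewrite !inE; apply/negP=> /imsetP[j _ /eqP]; rewrite eq_rlshift. Qed.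
Let lpr (A : {set 'I_(msz N)}) : lsh M N @^-1: (rsh M N @: A) = set0.
Proof. by apply/setP=> i; rewrite !inE; apply/negP=> /imsetP[j _ /eqP]; rewrite eq_lrshift. Qed.

Lemma ind_lshift (A : {set 'I_(msz M)}) : (lsh M N @: A \in mind L) = (A \in mind M).
Proof.
rewrite ind_freeprod // /lpart /rpart lpS rpl rk_set0 addn0 card_imset; last exact: lshift_inj.
case: (boolP (A \in mind M)) => //= AM.
by rewrite -(rk_ind mM AM) rkS ?subsetT.
Qed.

Lemma freeprod_via_l : @minor_via M L set0 U (lsh M N).
Proof.
split; [exact: lshift_inj | by rewrite setD0 | move=> B].
rewrite rk_set0 addn0 setU0; apply/eqP; rewrite eqn_leq; apply/andP; split; apply: rk_le => C CM CB.
  rewrite -(card_imset _ (@lshift_inj (msz M) (msz N))); apply: (@rk_max L); last exact: imsetS.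
  by rewrite ind_lshift.
have CE : lsh M N @: (lsh M N @^-1: C) = C.
  by apply: imset_preim; apply: subset_trans CB _; apply: imsetS; apply: subsetT.
rewrite -CE card_imset; last exact: lshift_inj.
apply: rk_max; first by rewrite -ind_lshift CE.
by rewrite -(lpS B) preimsetS.
Qed.

(** The bound in [ind_freeprod] caps the rank, and a basis of [B] together with a basis of [M]
    attains it. *)
Lemma rk_freeprod_r (B : {set 'I_(msz N)}) :
  rk (rsh M N @: B :|: U : {set 'I_(msz L)}) = rk B + rk [set: 'I_(msz M)].
Proof.
have lpE : lsh M N @^-1: (rsh M N @: B :|: U) = setT by rewrite preimsetU lpr lpS set0U.
have rpE : rsh M N @^-1: (rsh M N @: B :|: U) = B by rewrite preimsetU rpS rpl setU0.
apply/eqP; rewrite eqn_leq; apply/andP; split.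
  apply: rk_le => C; rewrite ind_freeprod // /lpart /rpart => /andP[_ cC] CB.
  apply: leq_trans cC _; rewrite addnC leq_add2r; apply: rkS.
  by have := preimsetS (rsh M N) CB; rewrite rpE.
have [I [IM _ cI]] := rk_basis mM setT; have [J [JN JB cJ]] := rk_basis mN B.
pose K : {set 'I_(msz L)} := rsh M N @: J :|: lsh M N @: I.
have lK : lsh M N @^-1: K = I by rewrite preimsetU lpr lpS set0U.
have rK : rsh M N @^-1: K = J by rewrite preimsetU rpS rpl setU0.
have cK : #|K| = #|J| + #|I| by rewrite card_split /lpart /rpart lK rK addnC.
rewrite -cJ -cI -cK; apply: rk_max.
  by rewrite ind_freeprod // /lpart /rpart lK IM rK cK cI (rk_ind mN JN) addnC /=.
by apply: setUSS; apply: imsetS => //; apply: subsetT.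
Qed.

Lemma freeprod_via_r : @minor_via N L U setT (rsh M N).
Proof.
split; [exact: rshift_inj | | move=> B].
  apply/setP=> x; rewrite !inE andbT; apply/imsetP/idP => [[i _ ->]|].
    by apply/negP=> /imsetP[j _ /eqP]; rewrite eq_rlshift.
  case: (splitP x) => i ei; last by exists i => //; apply/val_inj.
  have -> : x = lshift _ i by apply/val_inj.
  by rewrite imset_f.
rewrite rk_freeprod_r; congr (_ + _).
have := rk_freeprod_r set0; rewrite imset0 set0U rk_set0 add0n.
by [].
Qed.

Lemma freeprod_sep : @free_sep L U.
Proof.
move=> X; have -> : X :&: U = lsh M N @: (lsh M N @^-1: X).
  apply/setP=> y; apply/setIP/imsetP => [[yX /imsetP[i _ e]]|[i]].
    by exists i => //; rewrite inE -e.
  by rewrite inE => iX ->; split=> //; apply: imset_f.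
rewrite ind_lshift => h1.
have -> : X :|: U = rsh M N @: (rsh M N @^-1: X) :|: U.
  apply/setP=> y; rewrite !inE; case: (splitP y) => i ei.
    have -> : y = lshift _ i by apply/val_inj.
    have -> : lsh M N i \in U by rewrite imset_f.
    by rewrite !orbT.
  have -> : y = rshift _ i by apply/val_inj.
  by rewrite mem_imset ?inE //; apply: rshift_inj.
by rewrite rk_freeprod_r ind_freeprod // h1 addnC.
Qed.

End Factors.

(** * Intersections of free separators, and disjoint pairs of them *)

Section Separators.
Variable L : matroid.
Hypothesis mL : matroidb L.
Implicit Types U V W X : {set 'I_(msz L)}.

Lemma free_sepT : free_sep [set: 'I_(msz L)].
Proof. by move=> X; rewrite setIT. Qed.

(** Removing [X :\: U] costs at most its cardinality in rank, so [X :&: U] passes the test for [V]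
    and is independent. Then [X] passes the test for [U]. *)
Lemma free_sepI U V : free_sep U -> free_sep V -> free_sep (U :&: V).
Proof.
move=> fU fV X XI cX.
have XU : X :&: U \in mind L.
  apply: fV; first by rewrite -setIA.
  have h1 : rk (X :|: U :&: V) <= rk ((X :&: U) :|: V) + #|X :\: U|.
    apply: leq_trans (rkU_card mL _ _); apply: rkS; apply/subsetP=> x; rewrite !inE.
    by case: (x \in X); case: (x \in U); case: (x \in V).
  have h2 := cardsID U X; slia.
apply: fU => //; apply: leq_trans cX _; apply: rkS; apply: setUS; exact: subsetIl.
Qed.

Section Disjoint.
Variables U V : {set 'I_(msz L)}.
Hypotheses (fU : free_sep U) (fV : free_sep V).
Hypotheses (UV : U :&: V = set0) (V0 : V != set0).

(** By [span_mono] a circuit [C] inside [X] is enough. If [C] did not span [U], the test for [U]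
    would force it inside [U]. It then misses [V], so the test for [V] makes it span [V]. Exchanging
    an element of [C] for one of [V] gives a set that passes the test for [U], yet is too large for
    the rank of [C :|: V]. *)
Lemma dep_span X : X \notin mind L -> rk (X :|: U) = rk X.
Proof.
move=> XM.
have [C /minsetP[CM Cmin] CX] : {C | minset (fun C => C \notin mind L) C & C \subset X}.
  exact: minset_exists XM.
apply: (@span_mono _ mL C) => //.
have le1 : rk C < #|C|.
  by rewrite ltn_neqAle rk_card andbT; rewrite ind_rk // in CM.
apply/eqP; rewrite eqn_leq [X in _ && X]rkS ?subsetUl // andbT leqNgt; apply/negP=> lt.
have Csub (D : {set 'I_(msz L)}) : D \proper C -> D \in mind L.
  move=> DC; apply/negPn/negP=> DM; move: (DC); rewrite (Cmin D DM) ?properxx //.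
  exact: proper_sub.
have [c cC] : exists c, c \in C by apply/set0Pn; rewrite -card_gt0; slia.
have cCc : #|C| = #|C :\ c|.+1 by rewrite (cardsD1 c) cC.
have Cc : C :\ c \in mind L by apply: Csub; apply: properD1.
have rC : rk C = #|C :\ c|.
  apply/eqP; rewrite eqn_leq [X in _ && X](rk_max Cc) ?subsetDl // andbT.
  by rewrite -ltnS -cCc.
have CU : C \subset U.
  apply/setIidPl/eqP; rewrite eqEsubset subsetIl /=; apply/negPn/negP=> CU.
  have /Csub CUM : C :&: U \proper C by rewrite properE subsetIl CU.
  by case/negP: CM; apply: fU CUM _; move: lt; rewrite rC; slia.
have CV : rk (C :|: V) = rk C.
  apply/eqP; rewrite eqn_leq [X in _ && X]rkS ?subsetUl // andbT leqNgt; apply/negP=> ltV.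
  case/negP: CM; apply: fV; last by move: ltV; rewrite rC; slia.
  suff -> : C :&: V = set0 by apply: ind0.
  by apply/eqP; rewrite -subset0 -UV; apply: setSI.
have [v vV] := set0Pn _ V0.
have vU : v \notin U by apply/negP=> vU; have := in_set0 v; rewrite -UV inE vU vV.
have vC : v \notin C by apply: contra vU; apply: (subsetP CU).
pose D := v |: C :\ c.
have cD : #|D| = #|C| by rewrite cardsU1 !inE (negbTE vC) andbF cCc.
have DM : D \in mind L.
  apply: fU.
    suff -> : D :&: U = C :\ c by [].
    apply/setP=> x; rewrite !inE; case: eqP => [->|_] /=.
      by rewrite (negbTE vU) (negbTE vC) andbF.
    by case xC: (x \in C); rewrite ?andbF ?andbT //= (subsetP CU) ?andbT.
  rewrite cD cCc -rC; apply: leq_trans lt _; apply: rkS.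
  by rewrite (setUidPr CU) subsetUr.
have : #|D| <= rk (C :|: V).
  apply: rk_max => //; rewrite subUset sub1set inE vV orbT /=.
  by apply: subset_trans (subsetDl _ _) (subsetUl _ _).
by rewrite CV rC cD cCc ltnn.
Qed.

(** A dependent set already spans [U], so joining part of [U] cannot lift its rank to its
    cardinality: only independent sets pass the test. Against irreducibility, this shrinks [U] to
    one element. *)
Lemma sub_free_sep W : W \subset U -> free_sep W.
Proof.
move=> WU X _ cX; apply/negPn/negP=> XM; have := dep_span XM.
have : rk (X :|: W) <= rk (X :|: U) by apply: rkS; apply: setUS.
have := rk_card X; move: XM; rewrite ind_rk // => /eqP; slia.
Qed.

End Disjoint.

(** A dependent image [X'] would span [U] and then [V]. As [X] differs from [X'] only inside these
    two, its rank would be at most [rk X'], below [#|X'| = #|X|]. *)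
Lemma swap_ind U V u v X : free_sep U -> free_sep V -> U :&: V = set0 -> u \in U -> v \in V ->
  X \in mind L -> tperm u v @: X \in mind L.
Proof.
move=> fU fV UV uU vV XM; apply/negPn/negP; set X' := _ @: X => X'M.
have V0 : V != set0 by apply/set0Pn; exists v.
have U0 : U != set0 by apply/set0Pn; exists u.
have e1 := dep_span fU fV UV V0 X'M.
have X'UM : X' :|: U \notin mind L by apply: contra X'M => /(indS mL); apply; apply: subsetUl.
have e2 : rk (X' :|: U :|: V) = rk (X' :|: U).
  by apply: dep_span fV fU _ U0 _ X'UM; rewrite setIC.
have : rk X <= rk (X' :|: U :|: V).
  apply: rkS; apply/subsetP=> x xX; rewrite !inE.
  have [->|xu] := eqVneq x u; first by rewrite uU orbT.
  have [->|xv] := eqVneq x v; first by rewrite vV orbT.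
  by rewrite (_ : x \in X') //; apply/imsetP; exists x => //; rewrite tpermD // eq_sym.
have cX' : #|X'| = #|X| by rewrite card_imset //; apply: perm_inj.
have := rk_card X'; move: X'M; rewrite ind_rk // e2 e1 (rk_ind mL XM) cX' => /eqP; slia.
Qed.

End Separators.

(** * Minors are matroids; free products up to isomorphism *)

(** [minor_via] speaks of rank only, so the last hypothesis ties independence to it. The axioms are
    then read off from ranks in [L] of images joined with [U]. *)
Lemma minor_matroid N L U V f : matroidb L -> @minor_via N L U V f ->
  (forall A, (A \in mind N) = (rk A == #|A|)) -> matroidb N.
Proof.
move=> mL v h; case: v => fi fT fr; apply/and3P; split.
- by rewrite h rk_set0 cards0.
- apply/forallP=> A; apply/forallP=> B; apply/implyP; rewrite !h => /andP[/eqP rA BA].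
  rewrite eqn_leq rk_card /=.
  have := rkD_card mL (f @: B :|: U) (f @: A :|: U).
  have cD : #|(f @: A :|: U) :\: (f @: B :|: U)| <= #|A :\: B|.
    rewrite -(card_imset _ fi) imsetDinj //; apply: subset_leq_card; apply/subsetP=> x.
    by rewrite !inE; case: (x \in U); rewrite ?orbT ?orbF.
  have := cardsD A B; rewrite (setIidPr BA); have := subset_leq_card BA.
  rewrite -!fr rA; move: cD; slia.
apply/forallP=> A; apply/forallP=> B; apply/implyP; rewrite !h => /and3P[/eqP rA /eqP rB lt].
have [|x [xB xA rx]] := @rk_aug _ mL (f @: A :|: U) (f @: B :|: U).
  by rewrite -!fr rA rB ltn_add2r.
move: xB xA; rewrite !inE negb_or => xB /andP[xA xU]; move: xB; rewrite (negbTE xU) orbF.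
case/imsetP=> b bB ex; rewrite ex mem_imset // in xA.
apply/existsP; exists b; rewrite inE xA bB h eqn_leq rk_card cardsU1 xA /=.
by rewrite -(leq_add2r (rk U)) fr imsetU1 -ex -setUA -rA add1n addSn fr.
Qed.

Lemma restr_matroid M A : matroidb M -> matroidb (restr M A).
Proof.
move=> mM; apply: (minor_matroid mM (restr_via A)) => B.
have [ei _ er] := restr_via A; have := er B.
by rewrite rk_set0 addn0 setU0 => ->; rewrite inE ind_rk // card_imset.
Qed.

Lemma contr_matroid M A : matroidb M -> matroidb (contr M A).
Proof.
move=> mM; apply: (minor_matroid mM (contr_via A mM)) => B.
have [_ _ er] := contr_via A mM.
by rewrite inE -er eqn_add2r.
Qed.

Lemma minor_via_id L : @minor_via L L set0 setT id.
Proof. by split=> // [|B]; rewrite ?imset_id ?setD0 // rk_set0 addn0 setU0. Qed.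

Lemma freeprod_idr M N : matroidb M -> matroidb N -> msz N = 0 -> isob (freeprod M N) M.
Proof.
move=> mM mN N0; have mL := freeprod_matroid mM mN.
apply: (minor_via_uniq mL mM (minor_via_id _)).
suff <- : [set lsh M N x | x in setT] = setT :> {set 'I_(msz (freeprod M N))} by apply: freeprod_via_l.
apply/eqP; rewrite eqEcard subsetT card_imset; last exact: lshift_inj.
by rewrite !cardsT !card_ord /= N0 addn0.
Qed.

Lemma freeprod_idl M N : matroidb M -> matroidb N -> msz M = 0 -> isob (freeprod M N) N.
Proof.
move=> mM mN M0; have mL := freeprod_matroid mM mN.
apply: (minor_via_uniq mL mN (minor_via_id _)).
suff <- : [set lsh M N x | x in setT] = set0 :> {set 'I_(msz (freeprod M N))} by apply: freeprod_via_r.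
apply/eqP; rewrite -cards_eq0 card_imset; last exact: lshift_inj.
by rewrite !cardsT !card_ord M0.
Qed.

(** [M] and [N] are copies of the two minors of [freeprod M' N'] at its canonical separator, so they
    glue to it. *)
Lemma freeprod_isob M M' N N' : matroidb M -> matroidb N -> isob M M' -> isob N N' ->
  isob (freeprod M N) (freeprod M' N').
Proof.
move=> mM mN iM iN; have mM' := isob_matroid iM mM; have mN' := isob_matroid iN mN.
have [f vf] := isob_minor iM; have [g vg] := isob_minor iN.
have vM := minor_via_comp (freeprod_via_l N' mM') vf.
have vN := minor_via_comp (freeprod_via_r mM' mN') vg.
have sep := freeprod_sep mM' mN'.
rewrite !imset0 !setU0 set0U in vM vN.
have {}vN := minor_via_eq (erefl _) (_ : _ = setT) (fun _ => erefl _) vN.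
apply: glue_isob (freeprod_matroid mM' mN') mM vM (vN _) sep.
apply/setP=> x; rewrite !inE; case: (splitP x) => i ei.
  have -> : x = lshift _ i by apply/val_inj.
  by rewrite imset_f.
have -> : x = rshift _ i by apply/val_inj.
by rewrite [X in _ || X]imset_f ?orbT.
Qed.

Lemma matroid_emptyM : matroidb emptyM.
Proof.
have h (A : {set 'I_0}) : A = set0 by apply/setP=> -[].
apply/and3P; split; first by rewrite inE.
  by apply/forallP=> A; apply/forallP=> B; rewrite (h B) !inE eqxx implybT.
by apply/forallP=> A; apply/forallP=> B; rewrite (h A) (h B) cards0 ltnn !andbF.
Qed.

(** Both sides are isomorphic to [freeprod M emptyM], as either factor is neutral. *)
Lemma isob_empty M : matroidb M -> msz M = 0 -> isob emptyM M.
Proof.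
move=> mM M0; rewrite isob_sym; apply: isob_trans (freeprod_idl mM matroid_emptyM M0).
by rewrite isob_sym; apply: freeprod_idr matroid_emptyM _.
Qed.

Lemma fprod_matroid s : (forall N, List.In N s -> matroidb N) -> matroidb (fprod_seq s).
Proof.
elim: s => [|M s IH] h; first exact: matroid_emptyM.
by apply: freeprod_matroid; [apply: h; left | apply: IH => N Ns; apply: h; right].
Qed.

Lemma free_sep_pull N L (U W : {set 'I_(msz L)}) f : matroidb N -> matroidb L -> @minor_via N L set0 U f ->
  W \subset U -> free_sep W -> free_sep (f @^-1: W).
Proof.
move=> mN mL [fi fT fr] WU fW X XI cX.
have fr' (B : {set 'I_(msz N)}) : rk B = rk (f @: B) by have := fr B; rewrite rk_set0 addn0 setU0.
have fi' (B : {set 'I_(msz N)}) : (B \in mind N) = (f @: B \in mind L).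
  by rewrite !ind_rk // fr' card_imset.
have fpW : f @: (f @^-1: W) = W by apply: imset_preim; rewrite fT setD0.
rewrite fi'; apply: fW.
  rewrite -fpW -imsetI ?fpW -?fi' //; exact: in2W.
by rewrite -[in X in _ <= X]fpW -imsetU -fr' card_imset.
Qed.

Lemma free_sep_push N L U f : matroidb N -> matroidb L -> @minor_via N L set0 setT f ->
  free_sep U -> free_sep (f @: U).
Proof.
move=> mN mL [fi fT fr] fU X XI cX.
have fr' (B : {set 'I_(msz N)}) : rk B = rk (f @: B) by have := fr B; rewrite rk_set0 addn0 setU0.
have fi' (B : {set 'I_(msz N)}) : (B \in mind N) = (f @: B \in mind L).
  by rewrite !ind_rk // fr' card_imset.
have fX : f @: (f @^-1: X) = X by apply: imset_preim; rewrite fT setD0 subsetT.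
rewrite -fX -fi'; apply: fU.
  by rewrite fi' imsetI ?fX //; apply: in2W.
by rewrite -(card_imset _ fi) fr' imsetU fX.
Qed.

(** * Irreducibility through separators, and cancellation of the first factor *)

Lemma sep_isob L U : matroidb L -> @free_sep L U -> isob L (freeprod (restr L U) (contr L U)).
Proof.
move=> mL fU; rewrite isob_sym.
exact: glue_isob mL (restr_matroid _ mL) (restr_via U) (contr_via U mL) fU.
Qed.

(** The factorization at [W] must contain a copy of [M]; by counting elements, that factor is
    everything and the other one is empty. *)
Lemma irreducible_sep M W : matroidb M -> irreducible M -> @free_sep M W -> W = set0 \/ W = setT.
Proof.
move=> mM [M0 irr] fW.
have [N Ns||N [Ns iN]] := irr [:: restr M W; contr M W].
- by case: Ns => [<-|[<-|[]]]; [apply: restr_matroid | apply: contr_matroid].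
- apply: isob_trans (sep_isob mM fW) _; rewrite isob_sym.
  apply: freeprod_isob; [exact: restr_matroid| |exact: isob_refl|].
    by apply: freeprod_matroid matroid_emptyM; apply: contr_matroid.
  by apply: freeprod_idr matroid_emptyM _ => //; apply: contr_matroid.
have sN := isob_msz iN; case: Ns => [eN|[eN|[]]]; move: sN; rewrite -eN /= => sW.
  by right; apply/eqP; rewrite eqEcard subsetT cardsT card_ord sW /=.
left; apply/eqP; rewrite -cards_eq0.
have := cardsC W; rewrite card_ord sW; slia.
Qed.

Lemma sep_irreducible M : matroidb M -> 0 < msz M ->
  (forall W, @free_sep M W -> W = set0 \/ W = setT) -> irreducible M.
Proof.
move=> mM M0 h; split=> // s; elim: s => [|N s IH] ms iM.
  by have := isob_msz iM; move: M0 => /[swap] /= ->.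
have mN : matroidb N by apply: ms; left.
have mS : matroidb (fprod_seq s) by apply: fprod_matroid => A As; apply: ms; right.
have iM' : isob (freeprod N (fprod_seq s)) M by rewrite isob_sym.
have [f vf] := isob_minor iM'.
have mL := freeprod_matroid mN mS.
have [fi _ _] := vf.
have := h _ (free_sep_push mL mM vf (freeprod_sep mN mS)).
have cU : #|f @: (lsh N (fprod_seq s) @: setT)| = msz N.
  by rewrite !card_imset ?cardsT ?card_ord //; apply: lshift_inj.
have sM := isob_msz iM; rewrite /= in sM.
case=> eU; rewrite eU ?cards0 ?cardsT ?card_ord in cU.
  have [|A [As iA]] := IH _ (isob_trans iM (freeprod_idl mN mS (esym cU))).
    by move=> A As; apply: ms; right.
  by exists A; split=> //; right.
exists N; split; first by left.
rewrite isob_sym; apply: isob_trans iM _; apply: freeprod_idr => //.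
by move/eqP: sM; rewrite cU -[X in X == _]addn0 eqn_add2l eq_sym => /eqP.
Qed.

Lemma exists_atom L : matroidb L -> 0 < msz L -> exists U,
  [/\ @free_sep L U, U != set0 & forall W : {set 'I_(msz L)}, W \subset U -> @free_sep L W -> W = set0 \/ W = U].
Proof.
move=> mL L0.
pose fsb (U : {set 'I_(msz L)}) := [forall X : {set 'I_(msz L)},
  (X :&: U \in mind L) ==> (#|X| <= rk (X :|: U)) ==> (X \in mind L)].
have fsP U : reflect (free_sep U) (fsb U).
  apply: (iffP forallP) => h X; first by move: (h X) => /implyP h1 /h1/implyP.
  by apply/implyP=> h1; apply/implyP; apply: h.
have hT : (setT != set0 :> {set 'I_(msz L)}) && fsb setT.
  by rewrite -cards_eq0 cardsT card_ord -lt0n L0; apply/fsP; apply: free_sepT.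
have [U /minsetP[/andP[U0 /fsP fU] Umin] _] := @minset_exists _ (fun U => (U != set0) && fsb U) _ hT.
exists U; split=> // W WU fW; have [->|W0] := eqVneq W set0; first by left.
by right; apply: Umin => //; rewrite W0; apply/fsP.
Qed.

(** Both first factors are placed in one [L], on separators [U] and [V]. Irreducibility of each
    makes the separator [U :&: V] either empty or equal to both; the second case is uniqueness of
    minors. *)
Lemma freeprod_cancel a b a' b' : matroidb a -> matroidb b -> matroidb a' -> matroidb b' ->
  irreducible a -> irreducible a' -> isob (freeprod a b) (freeprod a' b') ->
  isob a a' /\ isob b b'.
Proof.
move=> ma mb ma' mb' ia ia'; set L := freeprod a b; set L' := freeprod a' b'.
rewrite isob_sym => iL; have [g vg] := isob_minor iL.
have mL : matroidb L by apply: freeprod_matroid.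
have mL' : matroidb L' by apply: freeprod_matroid.
pose U : {set 'I_(msz L)} := lsh a b @: setT.
pose V : {set 'I_(msz L)} := g @: (lsh a' b' @: setT).
have va : minor_via set0 U (lsh a b) by apply: freeprod_via_l.
have vb : minor_via U setT (rsh a b) by apply: freeprod_via_r.
have gT : g @: setT = setT by case: vg => _ ->; rewrite setD0.
have va' : minor_via set0 V (g \o lsh a' b').
  by have := minor_via_comp vg (freeprod_via_l b' ma'); rewrite imset0 !set0U.
have vb' : minor_via V setT (g \o rsh a' b').
  by have := minor_via_comp vg (freeprod_via_r ma' mb'); rewrite !set0U gT.
have fU : free_sep U by apply: freeprod_sep.
have fV : free_sep V by apply: (free_sep_push mL' mL vg); apply: freeprod_sep.
clearbody U V.
have atom N Z h (W : {set 'I_(msz L)}) : matroidb N -> irreducible N -> @minor_via N L set0 Z h -> W \subset Z ->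
    free_sep W -> W = set0 \/ W = Z.
  move=> mN iN v WZ fW; have hW : h @: (h @^-1: W) = W.
    by case: v => hi hT _; apply: imset_preim; rewrite hT setD0.
  case: (irreducible_sep mN iN (free_sep_pull mN mL v WZ fW)) => e; rewrite e in hW.
    by left; rewrite -hW imset0.
  by right; rewrite -hW; case: v => _ -> _; rewrite setD0.
have nonempty N Z h : irreducible N -> @minor_via N L set0 Z h -> Z != set0.
  by move=> [N0 _] /minor_via_card; rewrite setD0 -card_gt0 => <-.
have U0 := nonempty _ _ _ ia va; have V0 := nonempty _ _ _ ia' va'.
have fUV := free_sepI mL fU fV.
have [UV|UV] := atom _ _ _ _ ma ia va (subsetIl U V) fUV; last first.
  have UV' : U = V.
    have [e|<- //] := atom _ _ _ _ ma' ia' va' (subsetIr U V) fUV.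
    by move: U0; rewrite -UV e eqxx.
  subst V; split; first exact: minor_via_uniq va va'.
  exact: minor_via_uniq vb vb'.
have [u uU] := set0Pn _ U0; have [v vV] := set0Pn _ V0.
have VU : V :&: U = set0 by rewrite setIC.
(* In the disjoint case all subsets of [U] and of [V] are separators, so irreducibility leaves room
   for one element in each. *)
have eU : U = [set u].
  have f1 : free_sep [set u] by apply: (sub_free_sep mL fU fV); rewrite ?sub1set.
  have [|/setP/(_ u)|-> //] := atom _ _ _ [set u] ma ia va _ f1; first by rewrite sub1set.
  by rewrite !inE eqxx.
have eV : V = [set v].
  have f1 : free_sep [set v] by apply: (sub_free_sep mL fV fU); rewrite ?sub1set.
  have [|/setP/(_ v)|-> //] := atom _ _ _ [set v] ma' ia' va' _ f1; first by rewrite sub1set.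
  by rewrite !inE eqxx.
pose t := tperm u v.
have tI : involutive t by apply: tpermK.
have ti : injective t by apply: inv_inj.
have tt (X : {set 'I_(msz L)}) : t @: (t @: X) = X.
  by rewrite -(imset_comp t) -[RHS]imset_id; apply: eq_imset => x /=; rewrite tI.
have tind (X : {set 'I_(msz L)}) : (X \in mind L) = (t @: X \in mind L).
  apply/idP/idP => h; first exact: (swap_ind mL fU fV UV uU vV h).
  by rewrite -(tt X); exact: (swap_ind mL fU fV UV uU vV h).
have trk (X : {set 'I_(msz L)}) : rk X = rk (t @: X).
  have le (Y : {set 'I_(msz L)}) : rk Y <= rk (t @: Y).
    apply: rk_le => C CM CY; rewrite -(card_imset _ ti); apply: rk_max; first by rewrite -tind.
    exact: imsetS.
  by apply/eqP; rewrite eqn_leq le /= -[X in _ <= rk X]tt le.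
have vt : minor_via set0 [set: 'I_(msz L)] t.
  split=> // [|B]; first by rewrite inj_full // setD0.
  by rewrite rk_set0 addn0 setU0.
(* The automorphism [t] carries [U] to [V], so [a] and [b] are also copies of the two minors at
   [V]. *)
have va2 : minor_via set0 V (t \o lsh a b).
  by have := minor_via_comp vt va; rewrite imset0 !set0U eU imset_set1 tpermL -eV.
have vb2 : minor_via V setT (t \o rsh a b).
  by have := minor_via_comp vt vb; rewrite !set0U eU imset_set1 tpermL -eV inj_full.
split; first exact: minor_via_uniq va2 va'.
exact: minor_via_uniq vb2 vb'.
Qed.

(** * The weak order *)

(* [L] is below [M] in the weak order on matroids. *)
Definition weak (L M : matroid) := exists h : 'I_(msz M) -> 'I_(msz L),
  [/\ msz M = msz L, injective h & forall A : {set 'I_(msz M)}, h @: A \in mind L -> A \in mind M].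

Lemma weak_trans L M N : weak L M -> weak M N -> weak L N.
Proof.
move=> [h [e hi hP]] [k [e' ki kP]]; exists (h \o k); split; [by rewrite e'|exact: inj_comp|].
by move=> A; rewrite (imset_comp h k) => /hP/kP.
Qed.

Lemma isob_weak L M : isob L M -> weak L M.
Proof. by rewrite isob_sym => /isobP[h [e hi hP]]; exists h; split=> // A; rewrite hP. Qed.

Lemma weak_card L M (h : 'I_(msz M) -> 'I_(msz L)) : msz M = msz L -> injective h ->
  #|[set A : {set 'I_(msz M)} | h @: A \in mind L]| = #|mind L|.
Proof.
move=> e hi; rewrite -(card_imset _ (imset_inj hi)); apply: eq_card => B.
apply/imsetP/idP => [[A]|BL]; first by rewrite inE => hA ->.
have hB : h @: (h @^-1: B) = B by apply: imset_preim; rewrite (inj_full e hi) subsetT.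
by exists (h @^-1: B); rewrite ?inE hB.
Qed.

Lemma weak_leq L M : weak L M -> #|mind L| <= #|mind M|.
Proof.
case=> h [e hi hP]; rewrite -(weak_card e hi); apply: subset_leq_card.
by apply/subsetP=> A; rewrite inE; apply: hP.
Qed.

(** With equally many independent sets, the inclusion of the two families is an equality. The number
    of independent sets thus grows strictly along strict comparisons, and it serves as [mu] in
    [triangular_inverse]. *)
Lemma weak_eq L M : weak L M -> #|mind L| = #|mind M| -> isob L M.
Proof.
case=> h [e hi hP] c; rewrite isob_sym; apply/isobP; exists h; split=> // A.
suff <- : [set A : {set 'I_(msz M)} | h @: A \in mind L] = mind M by rewrite inE.
apply/eqP; rewrite eqEcard (weak_card e hi) c leqnn andbT.
by apply/subsetP=> B; rewrite inE; apply: hP.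
Qed.

(** The left part of a set is unchanged and its right rank can only grow from [N] to [N']. Varying
    the right factor suffices, because [Pvec] fixes the left one up to isomorphism. *)
Lemma weak_freeprod M N N' : matroidb M -> weak N N' -> weak (freeprod M N) (freeprod M N').
Proof.
move=> mM [h [e hi hP]]; pose k := glue (L := freeprod M N) (N := N') (lsh M N) (rsh M N \o h).
have kE (A : {set 'I_(msz M + msz N')}) : k @: A = lsh M N @: lpart A :|: rsh M N @: (h @: rpart A).
  by rewrite glue_imset (imset_comp (rsh M N) h).
have ki : injective k.
  move=> x y; case: (splitP x) => i ei; case: (splitP y) => j ej.
  - have -> : x = lsh M N' i by apply/val_inj.
    have -> : y = lsh M N' j by apply/val_inj.
    by rewrite /k !glueL => /lshift_inj->.
  - have -> : x = lsh M N' i by apply/val_inj.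
    have -> : y = rsh M N' j by apply/val_inj.
    by rewrite /k glueL glueR /= => /eqP; rewrite eq_lrshift.
  - have -> : x = rsh M N' i by apply/val_inj.
    have -> : y = lsh M N' j by apply/val_inj.
    by rewrite /k glueL glueR /= => /eqP; rewrite eq_rlshift.
  - have -> : x = rsh M N' i by apply/val_inj.
    have -> : y = rsh M N' j by apply/val_inj.
    by rewrite /k !glueR /= => /rshift_inj/hi->.
have lk (A : {set 'I_(msz M + msz N')}) : lpart (k @: A : {set 'I_(msz M + msz N)}) = lpart A.
  apply/setP=> i; rewrite !inE kE inE mem_imset; last exact: lshift_inj.
  rewrite inE; case: (_ \in A) => //=; apply/negP=> /imsetP[j _ /eqP].
  by rewrite eq_lrshift.
have rk' (A : {set 'I_(msz M + msz N')}) : rpart (k @: A : {set 'I_(msz M + msz N)}) = h @: rpart A.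
  apply/setP=> i; rewrite !inE kE inE [X in _ || X]mem_imset; last exact: rshift_inj.
  case: (_ \in h @: _); rewrite ?orbT // orbF; apply/negP=> /imsetP[j _ /eqP].
  by rewrite eq_rlshift.
exists k; split=> //=; first by rewrite e.
move=> A; rewrite !ind_freeprod // lk rk' => /andP[-> /=]; rewrite card_imset // => cA.
apply: leq_trans cA _; rewrite leq_add2l; apply: rk_le => C CN CA.
have hC : h @: (h @^-1: C) = C by apply: imset_preim; rewrite (inj_full e hi) subsetT.
rewrite -hC card_imset //; apply: rk_max; first by apply: hP; rewrite hC.
by rewrite -(preim_imset hi (rpart A)) preimsetS.
Qed.

Lemma weak_minors L A : matroidb L -> weak L (freeprod (restr L A) (contr L A)).
Proof.
move=> mL; have mM := restr_matroid A mL.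
have vM := restr_via A; have vN := contr_via A mL.
exists (@glue L (restr L A) (contr L A) (emb A) (emb (~: A))); split; [exact: glue_msz vM vN|exact: glue_inj vM vN|].
by move=> B; apply: glue_weak mL mM vM vN _.
Qed.

Lemma restr_isob M N (f : 'I_(msz M) -> 'I_(msz N)) A : matroidb M -> matroidb N ->
  minor_via set0 setT f -> isob (restr M A) (restr N (f @: A)).
Proof.
move=> mM mN v; have := minor_via_comp v (restr_via A); rewrite imset0 !set0U => v'.
by apply: (minor_via_uniq _ _ v' (restr_via _)); apply: restr_matroid.
Qed.

Lemma contr_isob M N (f : 'I_(msz M) -> 'I_(msz N)) A : matroidb M -> matroidb N ->
  minor_via set0 setT f -> isob (contr M A) (contr N (f @: A)).
Proof.
move=> mM mN v; have := minor_via_comp v (contr_via A mM); rewrite !set0U.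
have -> : f @: setT = setT by case: v => _ -> _; rewrite setD0.
by move=> v'; apply: (minor_via_uniq _ _ v' (contr_via _ mN)); apply: contr_matroid.
Qed.

(** * Canonical representatives and atoms among separators *)

(** Pairs of a size and a set family have decidable equality; carried over to [matroid], it allows
    words in matroids to be compared. *)
Definition matroid_tag (M : matroid) : {n : nat & {set {set 'I_n}}} := existT _ (msz M) (mind M).
Definition matroid_untag (t : {n : nat & {set {set 'I_n}}}) : matroid := @Mat (tag t) (tagged t).
Lemma matroid_tagK : cancel matroid_tag matroid_untag. Proof. by case. Qed.
HB.instance Definition _ := Equality.copy matroid (can_type matroid_tagK).

Lemma InP (T : eqType) (x : T) s : List.In x s <-> x \in s.
Proof.
elim: s => [|y s IH] //=; rewrite inE; split=> [[->|/IH->]|/orP[/eqP->|/IH]]; rewrite ?eqxx ?orbT //.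
  by left.
by right.
Qed.

(** As in [free_sepI]: leaving out the elements outside [U] costs at most their number in rank, so
    [X :&: U] passes the test for [W], and then [X] passes the one for [U]. *)
Lemma sep_restr_trans L U (W : {set 'I_(msz (restr L U))}) : matroidb L -> @free_sep L U ->
  free_sep W -> @free_sep L (emb U @: W).
Proof.
move=> mL fU fW X XI cX; set W' := emb U @: W in XI cX.
have W'U : W' \subset U by apply: emb_sub.
have ei := @emb_inj _ U.
have [_ _ er] := restr_via U.
have er' (B : {set 'I_(msz (restr L U))}) : rk B = rk (emb U @: B).
  by have := er B; rewrite rk_set0 addn0 setU0.
have ind (B : {set 'I_(msz (restr L U))}) : (B \in mind (restr L U)) = (emb U @: B \in mind L).
  by rewrite inE.
apply: fU; last by apply: leq_trans cX (rkS _); apply: setUS.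
have eX : emb U @: (emb U @^-1: (X :&: U)) = X :&: U.
  by apply: imset_preim; rewrite emb_full subsetIr.
rewrite -eX -ind; apply: fW.
  by rewrite ind imsetI ?eX; [rewrite -setIA (setIidPr W'U)|exact: in2W].
rewrite -(card_imset _ ei) er' imsetU eX -/W'.
have h1 : rk (X :|: W') <= rk (X :&: U :|: W') + #|X :\: U|.
  apply: leq_trans (rkU_card mL _ _); apply: rkS; apply/subsetP=> x; rewrite !inE.
  by case: (x \in X); case: (x \in U); case: (x \in W').
by have h2 := cardsID U X; slia.
Qed.

Definition repset (M : matroid) : {set {set 'I_(msz M)}} :=
  [arg min_(D < mind M | isob (@Mat (msz M) D) M) nat_of_ord (enum_rank D)]%N.
Definition rep M : matroid := @Mat (msz M) (repset M).

Lemma repsetP M : isob (rep M) M /\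
  forall D, isob (@Mat (msz M) D) M -> (enum_rank (repset M) <= enum_rank D)%N.
Proof.
by rewrite /rep /repset; case: arg_minnP => [|D iD h]; [case: M => n D; apply: isob_refl|].
Qed.

Lemma rep_isob M : isob (rep M) M. Proof. by case: (repsetP M). Qed.

Lemma isrep_rep M : isrep (rep M).
Proof.
apply/forallP=> D; apply/implyP=> /= iD; have [i h] := repsetP M.
by apply: h; apply: isob_trans iD i.
Qed.

Lemma isrep_Mat_inj n (D E : {set {set 'I_n}}) : isrep (Mat D) -> isrep (Mat E) ->
  isob (Mat D) (Mat E) -> D = E.
Proof.
move=> /forallP hD /forallP hE i; apply: enum_rank_inj; apply/val_inj/eqP.
rewrite eqn_leq; apply/andP; split; last exact: (implyP (hE D)).
by apply: (implyP (hD E)); rewrite isob_sym.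
Qed.

Lemma isrep_inj M N : isrep M -> isrep N -> isob M N -> M = N.
Proof.
case: M N => [m D] [n E] rM rN i; have /= e := isob_msz i; subst n.
by rewrite (isrep_Mat_inj rM rN i).
Qed.

Lemma irreducible_isob M N : isob M N -> irreducible M -> irreducible N.
Proof.
move=> iMN [M0 h]; split; first by rewrite -(isob_msz iMN).
move=> s ms iN; have [A [As iA]] := h s ms (isob_trans iMN iN).
by exists A; split=> //; apply: isob_trans iA iMN.
Qed.

Lemma irreducible_sep_atom L U : matroidb L -> @free_sep L U -> U != set0 ->
  (forall W : {set 'I_(msz L)}, W \subset U -> @free_sep L W -> W = set0 \/ W = U) -> irreducible (restr L U).
Proof.
move=> mL fU U0 h; apply: sep_irreducible; [exact: restr_matroid|by rewrite /= card_gt0|].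
move=> W fW; have := h _ (emb_sub _) (sep_restr_trans mL fU fW).
case=> e; [left|right].
  by apply/eqP; rewrite -cards_eq0 -(card_imset _ (@emb_inj _ U)) e cards0.
by apply: (imset_inj (@emb_inj _ U)); rewrite e emb_full.
Qed.

Lemma msz_fprod_cat s t : msz (fprod_seq (s ++ t)) = (msz (fprod_seq s) + msz (fprod_seq t))%N.
Proof. by elim: s => [|M s IH] //=; rewrite -/(fprod_seq (s ++ t)) IH addnA. Qed.

Local Open Scope ring_scope.

Local Notation mul := Defs.mul.

(** * Triangular matrices and cuts of words *)

Section TriangularInverse.
Variables (K : fieldType) (T : finType) (C : {set T}) (a : T -> T -> K) (mu : T -> nat).
Hypothesis a_tri : forall L N, L \in C -> N \in C -> a L N != 0 -> (mu L < mu N)%N \/ L = N.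
Hypothesis a_diag : forall L, L \in C -> a L L != 0.

Lemma triangular_inverse : exists b : T -> T -> K,
  (forall M N, M \in C -> N \in C -> \sum_(L in C) b M L * a L N = (M == N)%:R) /\
  (forall L M, L \in C -> M \in C -> \sum_(N in C) a L N * b N M = (L == M)%:R).
Proof.
(* Off [C] the matrix is completed by the identity, so that it is triangular with nonzero diagonal
   on all of [T]. *)
pose a' L N := if (L \in C) && (N \in C) then a L N else (L == N)%:R.
pose A := \matrix_(i < #|T|, j < #|T|) a' (enum_val i) (enum_val j).
have tri L N : a' L N != 0 -> (mu L < mu N)%N \/ L = N.
  rewrite /a'; case: ifP => [/andP[]|_]; first exact: a_tri.
  by case: (L =P N) => [->|_]; [right|rewrite eqxx].
have diag L : a' L L != 0.
  by rewrite /a' andbb; case: ifP => [/a_diag//|_]; rewrite eqxx oner_neq0.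
have uA : A \in unitmx.
  rewrite -row_free_unit; apply: inj_row_free => v vA; apply/eqP/negPn/negP => v0.
  have [j0 vj0] : exists j, v 0 j != 0.
    apply/existsP; apply: contraNT v0; rewrite negb_exists => /forallP h.
    by apply/eqP/rowP=> j; rewrite mxE; apply/eqP; have := h j; rewrite negbK.
  (* A kernel vector is tested at the column where [mu] is least on its support; triangularity
     leaves only the diagonal term. *)
  case: (@arg_minnP _ j0 (fun j => v 0 j != 0) (fun j => mu (enum_val j)) vj0) => i vi imin.
  have := congr1 (fun M : 'rV_#|T| => M 0 i) vA; rewrite !mxE (bigD1 i) //= big1 => [|j ji].
    by move/eqP; rewrite addr0 mulf_eq0 (negbTE vi) mxE (negbTE (diag _)).
  have [->|vj] := eqVneq (v 0 j) 0; first by rewrite mul0r.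
  have [->|] := eqVneq (A j i) 0; first by rewrite mulr0.
  rewrite mxE => /tri[lt|/enum_val_inj e]; last by rewrite e eqxx in ji.
  by have := imin j vj; rewrite leqNgt lt.
pose b M N := invmx A (enum_rank M) (enum_rank N).
have aE L N : a' L N = A (enum_rank L) (enum_rank N) by rewrite mxE !enum_rankK.
have sumT (G : T -> K) : \sum_L G L = \sum_(i < #|T|) G (enum_val i) by rewrite -big_enum_val.
have b1 M N : \sum_L b M L * a' L N = (M == N)%:R.
  have := congr1 (fun X : 'M_#|T| => X (enum_rank M) (enum_rank N)) (mulVmx uA).
  rewrite !mxE (inj_eq enum_rank_inj) => <-; rewrite sumT; apply: eq_bigr => i _.
  by rewrite /b aE enum_valK.
have b2 L M : \sum_N a' L N * b N M = (L == M)%:R.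
  have := congr1 (fun X : 'M_#|T| => X (enum_rank L) (enum_rank M)) (mulmxV uA).
  rewrite !mxE (inj_eq enum_rank_inj) => <-; rewrite sumT; apply: eq_bigr => i _.
  by rewrite /b aE enum_valK.
exists b; split=> [M N MC NC|L M LC MC].
  rewrite -b1 big_mkcond; apply: eq_bigr => L _ /=; rewrite /a' NC andbT; case: ifP => // LC.
  by case: eqP => [e|]; [rewrite e NC in LC|rewrite mulr0].
rewrite -b2 big_mkcond; apply: eq_bigr => N _ /=; rewrite /a' LC /=; case: ifP => // NC.
by case: eqP => [e|]; [rewrite -e LC in NC|rewrite mul0r].
Qed.

End TriangularInverse.

Lemma NoDup_uniq (T : eqType) (s : seq T) : List.NoDup s -> uniq s.
Proof. by elim=> //= x t xt _ ->; rewrite andbT; apply/negP=> /InP. Qed.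

Lemma uniq_map_inj (T U : eqType) (f : T -> U) s : uniq (map f s) -> {in s &, injective f}.
Proof.
elim: s => //= x s IH /andP[xs us] a b; rewrite !inE.
move=> /orP[/eqP->|ha] /orP[/eqP->|hb] // e; last exact: IH.
  by case/negP: xs; rewrite e map_f.
by case/negP: xs; rewrite -e map_f.
Qed.

(** Only the cut at position [size s] can match. *)
Lemma sum_splits (R : nzRingType) (T : eqType) (w s t : seq T) :
  (w == s ++ t)%:R = \sum_(i < (size w).+1) (take i w == s)%:R * (drop i w == t)%:R :> R.
Proof.
case: eqP => [e|ne]; last first.
  rewrite big1 // => i _; case: eqP => [es|_]; last by rewrite mul0r.
  by case: eqP => [et|_]; [case: ne; rewrite -es -et cat_take_drop|rewrite mulr0].
have lt : (size s < (size w).+1)%N by rewrite e size_cat ltnS leq_addr.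
rewrite (bigD1 (Ordinal lt)) //= {1 2}e take_size_cat // drop_size_cat // !eqxx mulr1.
rewrite big1 ?addr0 // => i ne; case: eqP => [es|_]; last by rewrite mul0r.
case/eqP: ne; apply/val_inj; rewrite /= -es size_take.
by have := ltn_ord i; rewrite ltnS leq_eqVlt => /orP[/eqP->|->]; rewrite ?ltnn.
Qed.

(** * The minor algebra and the products P *)

Section Algebra.
Variables (K : fieldType) (F : matroid -> Prop).
Hypothesis charK0 : [pchar K] =i pred0.
Hypothesis F_iso : forall M N, isob M N -> F M -> F N.
Hypothesis F_mat : forall M, F M -> matroidb M.
Hypothesis F_restr : forall M A, F M -> F (restr M A).
Hypothesis F_contr : forall M A, F M -> F (contr M A).
Hypothesis F_empty : F emptyM.
Hypothesis F_prod : forall M N, F M -> F N -> F (freeprod M N).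
Implicit Types x y z : matroid -> K.

Definition isoinv x := forall M N, isob M N -> x M = x N.
Definition offF x := forall M, ~ F M -> x M = 0.
Definition homog n x := forall M, msz M != n -> x M = 0.

Lemma isob_bvecE M N : bvec K M N = (isob M N)%:R. Proof. by []. Qed.

Lemma isoinv_bvec M : isoinv (bvec K M).
Proof.
move=> A B iAB; rewrite /bvec; congr (_%:R); congr nat_of_bool.
apply/idP/idP => h; first exact: isob_trans h iAB.
by apply: isob_trans h _; rewrite isob_sym.
Qed.

Lemma bvec_isob M N : isob M N -> bvec K M =1 bvec K N.
Proof. by move=> iMN L; rewrite /bvec ![isob _ L]isob_sym; apply: (isoinv_bvec L iMN). Qed.

Lemma mulE x y L : F L -> mul F x y L = \sum_(A : {set 'I_(msz L)}) x (restr L A) * y (contr L A).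
Proof. by rewrite /mul; case: excluded_middle_informative. Qed.

Lemma mul_offF x y : offF (mul F x y).
Proof. by move=> L; rewrite /mul; case: excluded_middle_informative. Qed.

Lemma eq_mul x x' y y' : x =1 x' -> y =1 y' -> mul F x y =1 mul F x' y'.
Proof.
move=> ex ey L; have [FL|FL] := excluded_middle_informative (F L); last by rewrite !mul_offF.
rewrite !mulE //; by apply: eq_bigr => A _; rewrite ex ey.
Qed.

Lemma isoinv_mul x y : isoinv x -> isoinv y -> isoinv (mul F x y).
Proof.
move=> ix iy M N iMN; case: (excluded_middle_informative (F M)) => FM; last first.
  rewrite !mul_offF // => FN; apply: FM; apply: F_iso FN; by rewrite isob_sym.
have FN := F_iso iMN FM; rewrite !mulE //; have [f v] := isob_minor iMN.
have fi : injective f by case: v.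
have fT : f @: setT = setT by case: v => _ -> _; rewrite setD0.
rewrite [RHS](reindex (fun A : {set 'I_(msz M)} => f @: A)) /=; last first.
  exists (fun B : {set 'I_(msz N)} => f @^-1: B) => B _; first exact: preim_imset.
  by apply: imset_preim; rewrite fT subsetT.
apply: eq_bigr => A _; congr (_ * _); [apply: ix|apply: iy].
  by apply: restr_isob => //; apply: F_mat.
by apply: contr_isob => //; apply: F_mat.
Qed.

Lemma mul_homog m n x y : homog m x -> homog n y -> homog (m + n)%N (mul F x y).
Proof.
move=> hx hy L sL; have [FL|FL] := excluded_middle_informative (F L); last by rewrite mul_offF.
rewrite mulE //; apply: big1 => A _; have [sA|sA] := eqVneq #|A| m; last by rewrite hx ?mul0r.
rewrite [y _]hy ?mulr0 //=; apply: contra sL => /eqP sC; apply/eqP.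
by rewrite -sA -sC /= cardsC card_ord.
Qed.

(** Both sides are sums over chains [B \subset A] of ground subsets, with [x] on the bottom minor,
    [y] on the middle one and [z] on the top one. *)
Lemma mul_assoc x y z : isoinv x -> isoinv y -> isoinv z ->
  mul F (mul F x y) z =1 mul F x (mul F y z).
Proof.
move=> ix iy iz L; case: (excluded_middle_informative (F L)) => FL; last by rewrite !mul_offF.
rewrite !mulE //; have mL := F_mat FL.
(* The middle minor is written here as a restriction of [contr L B]. The left product yields it as a
   contraction of [restr L A]; both are copies of the minor on [A :\: B]. *)
pose phi (B A : {set 'I_(msz L)}) :=
  x (restr L B) * y (restr (contr L B) (emb (~: B) @^-1: A)) * z (contr L A).
transitivity (\sum_(A : {set 'I_(msz L)}) \sum_(B : {set 'I_(msz L)} | B \subset A) phi B A).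
  apply: eq_bigr => A _; rewrite mulE; last exact: F_restr.
  have ei := @emb_inj _ A.
  rewrite mulr_suml (reindex_onto (fun C : {set 'I_#|A|} => emb A @: C) (fun B : {set _} => emb A @^-1: B)) /=; last first.
    by move=> B BA; apply: imset_preim; rewrite emb_full.
  apply: eq_big => [C|C _]; first by rewrite preim_imset // eqxx andbT emb_sub.
  rewrite /phi; congr (_ * _ * _).
    apply: ix; have := minor_via_comp (restr_via A) (@restr_via (restr L A) C).
    rewrite imset0 !set0U => v.
    by apply: (minor_via_uniq _ _ v (restr_via _)); apply: restr_matroid => //; apply: restr_matroid.
  have mC : matroidb (restr L A) by apply: restr_matroid.
  have v1 := minor_via_comp (restr_via A) (@contr_via (restr L A) C mC).
  have v2 := minor_via_comp (contr_via (emb A @: C) mL) (@restr_via (contr L (emb A @: C)) (emb (~: (emb A @: C)) @^-1: A)).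
  apply: iy; apply: (minor_via_uniq _ _ v1); first exact: contr_matroid.
    by apply: restr_matroid; apply: contr_matroid.
  rewrite imset0 setU0 in v2; rewrite !set0U emb_full.
  suff e : emb A @: C :|: emb (~: (emb A @: C)) @: (emb (~: (emb A @: C)) @^-1: A) = A by rewrite e in v2; exact: v2.
  apply/setP=> i; rewrite inE; apply/orP/idP => [[/(subsetP (emb_sub _))//|/imsetP[j]]|iA].
    by rewrite inE => jA ->.
  have [iC|iC] := boolP (i \in emb A @: C); first by left.
  right; have : i \in emb (~: (emb A @: C)) @: setT by rewrite emb_full inE.
  by case/imsetP=> j _ ej; apply/imsetP; exists j => //; rewrite inE -ej.
rewrite (exchange_big_dep xpredT) //=; apply: eq_bigr => B _.
rewrite mulE ?mulr_sumr; last exact: F_contr.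
have ei := @emb_inj _ (~: B).
have disj (C : {set 'I_#|~: B|}) : emb (~: B) @^-1: B = set0.
  by apply/setP=> i; rewrite !inE; have := enum_valP i; rewrite inE => /negbTE.
rewrite (reindex_onto (fun C : {set 'I_#|~: B|} => B :|: emb (~: B) @: C)
  (fun A : {set _} => emb (~: B) @^-1: A)) /=; last first.
  move=> A BA; apply/setP=> i; rewrite inE; apply/orP/idP => [[/(subsetP BA)//|/imsetP[j]]|iA].
    by rewrite inE => jA ->.
  have [iB|iB] := boolP (i \in B); first by left.
  right; have : i \in emb (~: B) @: setT by rewrite emb_full inE.
  by case/imsetP=> j _ ej; apply/imsetP; exists j => //; rewrite inE -ej.
have eC (C : {set 'I_#|~: B|}) : emb (~: B) @^-1: (B :|: emb (~: B) @: C) = C.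
  by rewrite preimsetU (disj C) set0U preim_imset.
apply: eq_big => [C|C _]; first by rewrite eC eqxx subsetUl.
rewrite /phi eC -mulrA; congr (_ * (_ * _)).
have mC : matroidb (contr L B) by apply: contr_matroid.
apply: iz; have v1 := minor_via_comp (contr_via B mL) (@contr_via (contr L B) C mC).
apply: (minor_via_uniq _ _ (contr_via _ mL)); first exact: contr_matroid.
  exact: contr_matroid.
rewrite emb_full setUCr in v1; exact: v1.
Qed.

Lemma mul_bvec0 x : isoinv x -> offF x -> mul F (bvec K emptyM) x =1 x.
Proof.
move=> ix ox L; case: (excluded_middle_informative (F L)) => FL; last by rewrite mul_offF ?ox.
rewrite mulE // (bigD1 set0) //= big1 ?addr0 => [|A A0]; last first.
  rewrite isob_bvecE; case: (boolP (isob _ _)) => [/isob_msz /= e|_]; last by rewrite mul0r.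
  by move: A0; rewrite -cards_eq0 -e eqxx.
have mL := F_mat FL.
have -> : bvec K emptyM (restr L set0) = 1.
  by rewrite isob_bvecE isob_empty //= ?cards0 //; apply: restr_matroid.
rewrite mul1r; apply: ix; have := contr_via set0 mL => v.
by apply: (minor_via_uniq _ _ v (minor_via_id L)) => //; apply: contr_matroid.
Qed.

Lemma isoinv_Pvec s : isoinv (Pvec K F s).
Proof. by elim: s => [|M s IH] /=; [exact: isoinv_bvec|apply: isoinv_mul => //; exact: isoinv_bvec]. Qed.

Lemma Pvec_offF s : offF (Pvec K F s).
Proof.
case: s => [|M s] /=; last exact: mul_offF.
move=> M nF; rewrite isob_bvecE; case: (boolP (isob _ _)) => // i.
by case: nF; apply: F_iso i F_empty.
Qed.

Lemma bvec_homog M : homog (msz M) (bvec K M).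
Proof.
move=> N; rewrite isob_bvecE; case: (boolP (isob _ _)) => // /isob_msz ->.
by rewrite eqxx.
Qed.

Lemma Pvec_homog s : homog (msz (fprod_seq s)) (Pvec K F s).
Proof. by elim: s => [|M s IH] /=; [exact: (@bvec_homog emptyM)|exact: (mul_homog (@bvec_homog M) IH)]. Qed.

Lemma Pvec_cat s t : Pvec K F (s ++ t) =1 mul F (Pvec K F s) (Pvec K F t).
Proof.
elim: s => [|M s IH] L /=.
  by rewrite mul_bvec0 //; [exact: isoinv_Pvec|exact: Pvec_offF].
rewrite (eq_mul (fun _ => erefl _) IH) mul_assoc //; [exact: isoinv_bvec|exact: isoinv_Pvec..].
Qed.

(** A nonzero term gives an [A] where [restr L A] is a copy of the first letter and the rest of the
    word is nonzero on [contr L A]. [weak_minors] and [weak_freeprod] then lead to the induction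
    hypothesis. *)
Lemma Pvec_weak s L : (forall M, List.In M s -> matroidb M) -> Pvec K F s L != 0 -> weak L (fprod_seq s).
Proof.
elim: s L => [|M s IH] L ms /=.
  rewrite isob_bvecE; case: (boolP (isob _ _)) => [i _|_]; last by rewrite eqxx.
  by apply: isob_weak; rewrite isob_sym.
case: (excluded_middle_informative (F L)) => FL; last by rewrite mul_offF ?eqxx.
rewrite mulE // => nz; have mL := F_mat FL.
have [A hA] : exists A, bvec K M (restr L A) * Pvec K F s (contr L A) != 0.
  apply/existsP; apply: contraNT nz; rewrite negb_exists => /forallP h.
  by apply/eqP; apply: big1 => A _; apply/eqP; have := h A; rewrite negbK.
move: hA; rewrite mulf_eq0 negb_or isob_bvecE => /andP[].
case: (boolP (isob _ _)) => [iM _ hP|_]; last by rewrite eqxx.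
have w := IH _ (fun N Ns => ms N (or_intror Ns)) hP.
have mM : matroidb M by apply: ms; left.
apply: weak_trans (weak_minors A mL) _; apply: weak_trans (weak_freeprod mM w).
apply: isob_weak; apply: freeprod_isob; [exact: restr_matroid|exact: contr_matroid| |exact: isob_refl].
by rewrite isob_sym.
Qed.

Lemma Pvec_nat s L : exists n, Pvec K F s L = n%:R.
Proof.
elim: s L => [|M s IH] L /=; first by exists (isob emptyM L).
case: (excluded_middle_informative (F L)) => FL; last by exists 0; rewrite mul_offF.
rewrite mulE //; elim/big_ind: _ => [|a b [m ->] [n ->]|A _]; first by exists 0.
  by exists (m + n)%N; rewrite natrD.
by have [n ->] := IH (contr L A); exists (isob M (restr L A) * n)%N; rewrite natrM.
Qed.

(** The ground set of the left factor contributes a positive term, and by [Pvec_nat] all other terms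
    are natural numbers, so nothing cancels it. *)
Lemma Pvec_pos s : (forall M, List.In M s -> F M) ->
  exists n, Pvec K F s (fprod_seq s) = n.+1%:R.
Proof.
elim: s => [|M s IH] Fs /=; first by exists 0%N; rewrite isob_bvecE isob_refl.
have FM : F M by apply: Fs; left.
have Fs' : F (fprod_seq s).
  have : forall M, List.In M s -> F M by move=> N Ns; apply: Fs; right.
  by elim: (s) => [//|N t IHt] h; apply: F_prod; [apply: h; left|apply: IHt => A At; apply: h; right].
have FL := F_prod FM Fs'; have mL := F_mat FL; have mM := F_mat FM; have ms := F_mat Fs'.
set L := freeprod _ _ in FL mL *.
have [n en] := IH (fun N Ns => Fs N (or_intror Ns)).
pose A : {set 'I_(msz L)} := lsh M (fprod_seq s) @: setT.
rewrite mulE // (bigD1 A) //=.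
have -> : bvec K M (restr L A) = 1.
  rewrite isob_bvecE (minor_via_uniq mM (restr_matroid A mL) (freeprod_via_l _ mM) (restr_via A)).
  by [].
have -> : Pvec K F s (contr L A) = n.+1%:R.
  rewrite -en; apply: isoinv_Pvec.
  exact: (minor_via_uniq (contr_matroid A mL) ms (contr_via A mL) (freeprod_via_r mM ms)).
have [m ->] : exists m, \sum_(B | B != A) bvec K M (restr L B) * Pvec K F s (contr L B) = m%:R.
  elim/big_ind: _ => [|a b [m ->] [p ->]|B _]; first by exists 0%N.
    by exists (m + p)%N; rewrite natrD.
  by have [p ->] := Pvec_nat s (contr L B); exists (isob M (restr L B) * p)%N; rewrite natrM.
by exists (n + m)%N; rewrite mul1r -natrD addSn.
Qed.

(** * Words in the irreducibles *)

(** The family is an arbitrary [Prop]; this lets it enter [all], finite sets and subtypes. *)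
Definition classicb (P : Prop) : bool := if excluded_middle_informative P then true else false.
Lemma classicbP P : reflect P (classicb P).
Proof. by rewrite /classicb; case: excluded_middle_informative => h; constructor. Qed.

(** One letter per isomorphism class, so that words with isomorphic products are equal and not
    merely letterwise isomorphic. *)
Definition irrF M := classicb (F M /\ irreducible M /\ isrep M).
Definition word (w : seq matroid) := all irrF w.

Lemma irrFP M : reflect (F M /\ irreducible M /\ isrep M) (irrF M).
Proof. exact: classicbP. Qed.

Lemma word_F w : word w -> F (fprod_seq w).
Proof. by elim: w => //= M w IH /andP[/irrFP[FM _] /IH]; apply: F_prod. Qed.

Lemma irrF_rep M : F M -> irreducible M -> irrF (rep M).
Proof.
move=> FM iM; have i : isob M (rep M) by rewrite isob_sym rep_isob.
by apply/irrFP; split; [exact: F_iso i FM|split; [exact: irreducible_isob i iM|exact: isrep_rep]].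
Qed.

(** Strong induction on size: a minimal nonempty separator carries the first letter, and the
    contraction by it is smaller. *)
Lemma word_factor M : F M -> exists w, word w /\ isob M (fprod_seq w).
Proof.
have [n] := ubnP (msz M); elim: n M => // n IH M lt FM; have mM := F_mat FM.
have [M0|M0] := posnP (msz M).
  by exists [::]; split=> //; rewrite isob_sym; apply: isob_empty.
have [U [fU U0 Uat]] := exists_atom mM M0.
have FU := F_restr U FM; have iU := irreducible_sep_atom mM fU U0 Uat.
have FC := F_contr U FM.
have [|w [gw iw]] := IH (contr M U) _ FC.
  have := cardsC U; rewrite card_ord /=; move: U0; rewrite -card_gt0; slia.
exists (rep (restr M U) :: w); split; first by rewrite /= irrF_rep.
apply: isob_trans (sep_isob mM fU) _; apply: freeprod_isob iw; [exact: F_mat|exact: F_mat|].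
by rewrite isob_sym rep_isob.
Qed.

Lemma word_uniq s t : word s -> word t -> isob (fprod_seq s) (fprod_seq t) -> s = t.
Proof.
elim: s t => [|a s IH] [|b t] //=.
- by move=> _ /andP[/irrFP[_ [[b0 _] _]] _] /isob_msz /= e; move: b0 e; case: (msz b).
- by move=> /andP[/irrFP[_ [[a0 _] _]] _] _ /isob_msz /= e; move: a0 e; case: (msz a).
move=> /andP[/irrFP[Fa [ia ra]] gs] /andP[/irrFP[Fb [ib rb]] gt] i.
have [iab ist] := freeprod_cancel (F_mat Fa) (F_mat (word_F gs)) (F_mat Fb) (F_mat (word_F gt)) ia ib i.
by rewrite (isrep_inj ra rb iab) (IH t).
Qed.

(** [dualQ] ranges over all irreducible factorizations; this replaces one by a word with the same
    [P]. The factors lie in [F] because they are minors of [N]. *)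
Lemma irrfact_word N s : F N -> irrfact N s ->
  exists w, [/\ word w, isob N (fprod_seq w) & Pvec K F s =1 Pvec K F w].
Proof.
elim: s N => [|a s IH] N FN [hs iN]; first by exists [::].
have [ma ia] := hs a (or_introl erefl).
have ms : matroidb (fprod_seq s) by apply: fprod_matroid => A As; case: (hs A (or_intror As)).
have FL : F (freeprod a (fprod_seq s)) by apply: F_iso FN.
have mL := F_mat FL.
have Fa : F a.
  apply: F_iso (F_restr (lsh a (fprod_seq s) @: setT : {set 'I_(msz (freeprod _ _))}) FL).
  exact: minor_via_uniq (restr_matroid _ mL) ma (restr_via _) (freeprod_via_l _ ma).
have Fs : F (fprod_seq s).
  apply: F_iso (F_contr (lsh a (fprod_seq s) @: setT : {set 'I_(msz (freeprod _ _))}) FL).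
  exact: minor_via_uniq (contr_matroid _ mL) ms (contr_via _ mL) (freeprod_via_r ma ms).
have [|w [gw iw Pw]] := IH _ Fs.
  by split; [move=> A As; apply: hs; right|exact: isob_refl].
have ra : isob a (rep a) by rewrite isob_sym rep_isob.
exists (rep a :: w); split; first by rewrite /= irrF_rep.
  by apply: isob_trans iN _; apply: freeprod_isob.
exact: eq_mul (@bvec_isob _ _ ra) Pw.
Qed.

(** On [F] the choice is harmless by [wd_eq]; elsewhere the value is arbitrary. *)
Definition wd M : seq matroid := epsilon (inhabits [::]) (fun w => word w /\ isob M (fprod_seq w)).

Lemma wdP M : F M -> word (wd M) /\ isob M (fprod_seq (wd M)).
Proof. by move=> FM; exact: (epsilon_spec _ (fun w => word w /\ isob M (fprod_seq w)) (word_factor FM)). Qed.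

Lemma wd_eq M w : word w -> isob M (fprod_seq w) -> wd M = w.
Proof.
move=> gw iw; have FM : F M by apply: F_iso (word_F gw); rewrite isob_sym.
have [g i] := wdP FM; apply: word_uniq => //.
by apply: isob_trans iw; rewrite isob_sym.
Qed.

Lemma word_In w M : word w -> List.In M w -> F M.
Proof. by move=> /allP gw /InP/gw/irrFP[]. Qed.

Lemma Pvec_wd_neq0 M : F M -> Pvec K F (wd M) M != 0.
Proof.
move=> FM; have [g i] := wdP FM.
have [n e] := Pvec_pos (fun A => word_In g).
by rewrite (isoinv_Pvec (wd M) i) e (proj1 (pcharf0P K) charK0).
Qed.

(** * The dual basis Q, size by size *)

Definition reps n : {set {set {set 'I_n}}} := [set D | isrep (@Mat n D) && classicb (F (@Mat n D))].

Lemma repsP n D : reflect (isrep (@Mat n D) /\ F (@Mat n D)) (D \in reps n).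
Proof. by rewrite inE; apply: (iffP andP) => -[? /classicbP]. Qed.

Lemma reps_inj n D E : D \in reps n -> E \in reps n -> isob (@Mat n D) (@Mat n E) = (D == E).
Proof.
move=> /repsP[rD _] /repsP[rE _]; apply/idP/eqP => [i|->]; last exact: isob_refl.
exact: isrep_Mat_inj i.
Qed.

Lemma reps_ex n M : F M -> msz M = n -> exists2 D, D \in reps n & isob (@Mat n D) M.
Proof.
move=> FM <-; exists (repset M); last exact: rep_isob.
by apply/repsP; split; [exact: isrep_rep|apply: F_iso FM; rewrite isob_sym; exact: rep_isob].
Qed.

(** A two-sided inverse: the first identity makes the [Q] dual to the [P], the second expands a
    class in the [P]. *)
Definition dual_spec n (b : {set {set 'I_n}} -> {set {set 'I_n}} -> K) :=
  let a := fun L N : {set {set 'I_n}} => Pvec K F (wd (@Mat n N)) (@Mat n L) in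
  (forall M N, M \in reps n -> N \in reps n -> \sum_(L in reps n) b M L * a L N = (M == N)%:R) /\
  (forall L M, L \in reps n -> M \in reps n -> \sum_(N in reps n) a L N * b N M = (L == M)%:R).

Lemma dual_ex n : exists b, @dual_spec n b.
Proof.
apply: (@triangular_inverse _ _ _ _ (fun D : {set {set 'I_n}} => #|D|)); last first.
  by move=> D /repsP[_ FD]; apply: Pvec_wd_neq0.
move=> L N LC NC; case/repsP: (NC) => _ FN nz; have [g i] := wdP FN.
have w : weak (@Mat n L) (@Mat n N).
  apply: weak_trans (isob_weak _); last by rewrite isob_sym; exact: i.
  by apply: Pvec_weak nz => // A /(word_In g)/F_mat.
have := weak_leq w; rewrite leq_eqVlt => /orP[/eqP e|]; last by left.
by right; apply/eqP; rewrite -reps_inj //; apply: weak_eq.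
Qed.

Definition dualmx n := epsilon (inhabits (fun _ _ => 0)) (@dual_spec n).
Lemma dualmxP n : dual_spec (@dualmx n).
Proof. exact: (epsilon_spec _ _ (dual_ex n)). Qed.

(** The double sum looks up the representatives of [M] and [N] in the matrix; it is zero when the
    sizes differ or one of the two is outside [F]. *)
Definition Qm (M N : matroid) : K :=
  \sum_(D in reps (msz N)) \sum_(E in reps (msz N))
    (isob (@Mat (msz N) D) M && isob (@Mat (msz N) E) N)%:R * dualmx D E.

Lemma Qm_reps n D E : D \in reps n -> E \in reps n -> Qm (@Mat n D) (@Mat n E) = dualmx D E.
Proof.
move=> Dr Er; rewrite /Qm /= (bigD1 D) //= (bigD1 E) //= !isob_refl mul1r.
rewrite [X in _ + X + _]big1 => [|E' /andP[E'r E'E]]; last first.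
  by rewrite (reps_inj E'r Er) (negbTE E'E) andbF mul0r.
rewrite big1 ?addr0 // => D' /andP[D'r D'D]; apply: big1 => E' _.
by rewrite (reps_inj D'r Dr) (negbTE D'D) mul0r.
Qed.

Lemma isob_congr A M N : isob M N -> isob A M = isob A N.
Proof.
by move=> i; apply/idP/idP => h; apply: isob_trans h _ => //; rewrite isob_sym.
Qed.

Lemma isoinv_Qm M : isoinv (Qm M).
Proof.
move=> [n D] [n' D'] i; have /= e := isob_msz i; subst n'; rewrite /Qm /=.
by apply: eq_bigr => A _; apply: eq_bigr => B _; rewrite (isob_congr _ i).
Qed.

Lemma Qm_isob M M' : isob M M' -> Qm M =1 Qm M'.
Proof.
move=> i N; rewrite /Qm.
by apply: eq_bigr => A _; apply: eq_bigr => B _; rewrite (isob_congr _ i).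
Qed.

Lemma Qm_offF M : offF (Qm M).
Proof.
move=> N nF; apply: big1 => D _; apply: big1 => E /repsP[_ FE].
case: (boolP (isob _ N)) => [i|_]; last by rewrite andbF mul0r.
by case: nF; apply: F_iso FE.
Qed.

Lemma Qm_homog M : homog (msz M) (Qm M).
Proof.
move=> N ne; apply: big1 => D _; apply: big1 => E _.
case: (boolP (isob _ M)) => [/isob_msz /= e|_]; last by rewrite mul0r.
by rewrite e eqxx in ne.
Qed.

Lemma KM_Qm M : KM K F (Qm M).
Proof.
split; first exact: isoinv_Qm.
split; first exact: Qm_offF.
by exists (msz M).+1 => N lt; apply: Qm_homog; rewrite gtn_eqF.
Qed.

(** * The pairing, and the coproduct as adjoint of the product *)

Definition ip n (x y : matroid -> K) : K := clsum n (fun L => x L * y L).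

Lemma ipE n x y : offF x -> ip n x y = \sum_(D in reps n) x (@Mat n D) * y (@Mat n D).
Proof.
move=> ox; rewrite /ip /clsum big_mkcond [RHS]big_mkcond; apply: eq_bigr => D _ /=; rewrite inE.
case: (isrep _) => //=; case: classicbP => // nF; by rewrite ox ?mul0r.
Qed.

Lemma ip_Qm_Pvec n M w : F M -> word w -> msz (fprod_seq w) = n ->
  ip n (Qm M) (Pvec K F w) = (isob M (fprod_seq w))%:R.
Proof.
move=> FM gw sw; rewrite ipE; last exact: Qm_offF.
have [sM|sM] := eqVneq (msz M) n; last first.
  rewrite big1 => [|D _]; last by rewrite Qm_homog ?mul0r //= eq_sym.
  by case: (boolP (isob _ _)) => // /isob_msz e; rewrite e sw eqxx in sM.
have [D1 D1r i1] := reps_ex FM sM; have [D2 D2r i2] := reps_ex (word_F gw) sw.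
have i1' : isob M (Mat D1) by rewrite isob_sym.
have [b1 _] := dualmxP n; have := b1 _ _ D1r D2r.
rewrite (wd_eq gw i2) => h.
rewrite (eq_bigr (fun D => dualmx D1 D * Pvec K F w (Mat D))) => [|D Dr]; last first.
  by rewrite (Qm_isob i1') Qm_reps.
by rewrite h -reps_inj // (isob_congr _ i2) isob_sym [in RHS]isob_sym (isob_congr _ i1').
Qed.

(** The second identity of [dual_spec], spread from representatives to all matroids: the coordinates
    of a class in the [P] are values of the [Q]. *)
Lemma bvec_expand N L : F N ->
  \sum_(D in reps (msz N)) Qm (Mat D) N * Pvec K F (wd (Mat D)) L = bvec K N L.
Proof.
move=> FN; have [sL|sL] := eqVneq (msz L) (msz N); last first.
  rewrite big1 => [|D /repsP[_ FD]]; last first.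
    rewrite [X in _ * X](@Pvec_homog) ?mulr0 //.
    by have [_ /isob_msz <-] := wdP FD.
  by rewrite /bvec; case: (boolP (isob _ _)) => // /isob_msz e; rewrite e eqxx in sL.
have [FL|FL] := excluded_middle_informative (F L); last first.
  rewrite big1 => [|D _]; last by rewrite [X in _ * X]Pvec_offF ?mulr0.
  rewrite /bvec; case: (boolP (isob _ _)) => // i; case: FL; exact: F_iso FN.
have [D1 D1r i1] := reps_ex FN erefl; have [D2 D2r i2] := reps_ex FL sL.
have [_ b2] := dualmxP (msz N); have := b2 _ _ D2r D1r => h.
have i1' : isob N (Mat D1) by rewrite isob_sym.
have i2' : isob L (Mat D2) by rewrite isob_sym.
rewrite (eq_bigr (fun D => Pvec K F (wd (Mat D)) (Mat D2) * dualmx D D1)) => [|D Dr]; last first.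
  by rewrite mulrC (isoinv_Qm _ i1') Qm_reps // (isoinv_Pvec _ i2').
by rewrite h /bvec -reps_inj // (isob_congr _ i1) isob_sym (isob_congr _ i2).
Qed.

Lemma ip_sum (I : Type) (r : seq I) (P : pred I) n x (c : I -> K) (u : I -> matroid -> K) :
  ip n x (fun L => \sum_(i <- r | P i) c i * u i L) = \sum_(i <- r | P i) c i * ip n x (u i).
Proof.
rewrite /ip /clsum; under eq_bigr => D _ do rewrite mulr_sumr.
rewrite exchange_big; apply: eq_bigr => i _; rewrite mulr_sumr.
by apply: eq_bigr => D _; rewrite mulrCA.
Qed.

Lemma eq_ip n x x' y y' : x =1 x' -> y =1 y' -> ip n x y = ip n x' y'.
Proof. by move=> ex ey; apply: eq_bigr => D _; rewrite ex ey. Qed.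

Lemma ip_lincomb (I : Type) n (b : I -> matroid -> K) l y :
  ip n (lincomb b l) y = \sum_(p <- l) p.2 * ip n (b p.1) y.
Proof.
rewrite /ip /clsum /lincomb; under eq_bigr => D _ do rewrite mulr_suml.
rewrite exchange_big; apply: eq_bigr => i _; rewrite mulr_sumr.
by apply: eq_bigr => D _; rewrite mulrA.
Qed.

Lemma ip_bvec x N : isoinv x -> ip (msz N) x (bvec K N) = x N.
Proof.
move=> ix; rewrite /ip /clsum (bigD1 (repset N)) /=; last exact: isrep_rep.
rewrite /bvec [isob N _]isob_sym rep_isob mulr1 big1 ?addr0; first exact: ix (rep_isob N).
move=> D /andP[rD ne]; case: (boolP (isob _ _)) => [i|_]; last by rewrite mulr0.
case/eqP: ne; apply: isrep_Mat_inj (isrep_rep N) _ => //.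
by rewrite isob_sym; apply: isob_trans i; apply: rep_isob.
Qed.

Lemma clsum_bvec n y L : isoinv y -> homog n y -> y L = clsum n (fun M => y M * bvec K M L).
Proof.
move=> iy hy; have [<-|ne] := eqVneq (msz L) n.
  rewrite -(ip_bvec L iy); apply: eq_bigr => D _; congr (_ * _).
  by rewrite /bvec isob_sym.
rewrite hy // /clsum big1 // => D _; rewrite /bvec; case: (boolP (isob _ _)) => [/isob_msz /= e|_].
  by rewrite e eqxx in ne.
by rewrite mulr0.
Qed.

Lemma mul_sum (I J : finType) (P : pred I) (Q : pred J) (c : I -> K) (d : J -> K) u v y z L :
  (forall M, y M = \sum_(i | P i) c i * u i M) -> (forall M, z M = \sum_(j | Q j) d j * v j M) ->
  mul F y z L = \sum_(i | P i) c i * \sum_(j | Q j) d j * mul F (u i) (v j) L.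
Proof.
move=> ey ez; have [FL|FL] := excluded_middle_informative (F L); last first.
  rewrite mul_offF // big1 // => i _; rewrite big1 ?mulr0 // => j _.
  by rewrite mul_offF // mulr0.
rewrite mulE //; under eq_bigr => A _ do rewrite ey ez mulr_suml.
rewrite exchange_big; apply: eq_bigr => i _ /=.
under eq_bigr => A _ do rewrite mulr_sumr.
rewrite exchange_big mulr_sumr; apply: eq_bigr => j _ /=.
rewrite mulE // !mulr_sumr; apply: eq_bigr => A _.
by rewrite mulrACA -mulrA.
Qed.

(** Adjunction on basis elements: both sides count the same subsets of each [L]. The product is cut
    to zero off [F], hence the condition on [x]. *)
Lemma deltaE x N1 N2 : offF x ->
  delta x N1 N2 = ip (msz N1 + msz N2) x (mul F (bvec K N1) (bvec K N2)).
Proof.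
move=> ox; apply: eq_bigr => D _; have [FL|FL] := excluded_middle_informative (F (Mat D)); last first.
  by rewrite ox // !mul0r.
congr (_ * _); rewrite mulE // -sum1_card natr_sum big_mkcond; apply: eq_bigr => A _ /=.
by rewrite inE /bvec [isob N1 _]isob_sym [isob N2 _]isob_sym -natrM mulnb; case: (_ && _).
Qed.

Lemma ip_mul n1 n2 x y z : offF x -> isoinv y -> isoinv z -> homog n1 y -> homog n2 z ->
  ip (n1 + n2) x (mul F y z) =
  clsum n1 (fun M1 => y M1 * clsum n2 (fun M2 => z M2 * delta x M1 M2)).
Proof.
move=> ox iy iz hy hz; have e L := mul_sum L (fun M => clsum_bvec M iy hy) (fun M => clsum_bvec M iz hz).
rewrite (eq_ip _ (fun _ => erefl _) e) ip_sum; apply: eq_bigr => D _; rewrite ip_sum.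
by congr (_ * _); apply: eq_bigr => E _; rewrite deltaE.
Qed.

(** Writing both classes in the [P] turns their product into concatenation of words, so the
    coproduct is governed by pairings with [P] of concatenations. *)
Lemma delta_expand x N1 N2 : offF x -> F N1 -> F N2 ->
  delta x N1 N2 = \sum_(D in reps (msz N1)) Qm (Mat D) N1 *
    \sum_(E in reps (msz N2)) Qm (Mat E) N2 *
      ip (msz N1 + msz N2) x (Pvec K F (wd (Mat D) ++ wd (Mat E))).
Proof.
move=> ox F1 F2; rewrite deltaE //.
have e L := mul_sum L (fun M => esym (bvec_expand M F1)) (fun M => esym (bvec_expand M F2)).
rewrite (eq_ip _ (fun _ => erefl _) e) ip_sum; apply: eq_bigr => D _; rewrite ip_sum.
congr (_ * _); apply: eq_bigr => E _; congr (_ * _).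
by apply: eq_ip => // L; rewrite Pvec_cat.
Qed.

Lemma delta_offF x N1 N2 : offF x -> ~ (F N1 /\ F N2) -> delta x N1 N2 = 0.
Proof.
move=> ox nF; rewrite deltaE // /ip /clsum big1 // => D _.
have [FL|FL] := excluded_middle_informative (F (Mat D)); last by rewrite ox // mul0r.
rewrite mulE // big1 ?mulr0 // => A _; rewrite /bvec.
case: (boolP (isob N1 _)) => [i1|_]; last by rewrite mul0r.
case: (boolP (isob N2 _)) => [i2|_]; last by rewrite mulr0.
rewrite isob_sym in i1; rewrite isob_sym in i2.
by case: nF; split; [apply: F_iso i1 _; apply: F_restr|apply: F_iso i2 _; apply: F_contr].
Qed.

(** The sum retains only the representative of [fprod_seq u]; if the sizes differ there is none, and
    the right side vanishes too. *)
Lemma Qm_word u N : F N -> word u ->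
  \sum_(D in reps (msz N)) Qm (Mat D) N * (u == wd (Mat D))%:R = Qm (fprod_seq u) N.
Proof.
move=> FN gu; have [su|su] := eqVneq (msz (fprod_seq u)) (msz N); last first.
  rewrite Qm_homog 1?eq_sym // big1 // => D /repsP[_ FD]; case: eqP => [e|_]; last by rewrite mulr0.
  by have [_ /isob_msz] := wdP FD; rewrite -e /= => e'; rewrite e' eqxx in su.
have [D0 D0r i0] := reps_ex (word_F gu) su.
rewrite (bigD1 D0) //= (wd_eq gu i0) eqxx mulr1 (Qm_isob i0) big1 ?addr0 // => D /andP[Dr ne].
case: eqP => [e|_]; last by rewrite mulr0.
have /repsP[_ FD] := Dr; have [_ iD] := wdP FD; rewrite -e in iD.
case/eqP: ne; apply/eqP; rewrite -(reps_inj Dr D0r); apply: isob_trans iD _.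
by rewrite isob_sym.
Qed.

Lemma delta_Qm w N1 N2 : word w -> delta (Qm (fprod_seq w)) N1 N2 =
  \sum_(i < (size w).+1) tens (Qm (fprod_seq (take i w))) (Qm (fprod_seq (drop i w))) N1 N2.
Proof.
move=> gw; rewrite /tens; have [[F1 F2]|nF] := excluded_middle_informative (F N1 /\ F N2); last first.
  rewrite (delta_offF (@Qm_offF _) nF) big1 // => i _.
  have [F1|F1] := excluded_middle_informative (F N1); last by rewrite Qm_offF ?mul0r.
  by rewrite [X in _ * X]Qm_offF ?mulr0 // => F2; apply: nF.
have gtd i : word (take i w) /\ word (drop i w).
  by apply/andP; rewrite -all_cat cat_take_drop.
rewrite delta_expand //; last exact: Qm_offF.
(* The deconcatenation is spread over the same double sum as [delta_expand]. For each pair of words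
   the cuts add up to the indicator of a concatenation, which is the pairing of [Qm] with [P]. *)
symmetry; under eq_bigr => i _ do
  rewrite -(Qm_word F1 (proj1 (gtd i))) -(Qm_word F2 (proj2 (gtd i))) mulr_suml.
rewrite exchange_big; apply: eq_bigr => D Dr /=.
under eq_bigr => i _ do rewrite -mulrA mulr_sumr.
rewrite -mulr_sumr; congr (_ * _); rewrite exchange_big; apply: eq_bigr => E Er /=.
under eq_bigr => i _ do rewrite mulrCA.
rewrite -mulr_sumr -sum_splits; congr (_ * _); symmetry.
have /repsP[_ FD] := Dr; have /repsP[_ FE] := Er.
have [gD iD] := wdP FD; have [gE iE] := wdP FE.
have gDE : word (wd (Mat D) ++ wd (Mat E)) by rewrite /word all_cat; apply/andP.
rewrite ip_Qm_Pvec //; last by rewrite msz_fprod_cat -(isob_msz iD) -(isob_msz iE).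
  congr (_%:R); congr nat_of_bool; apply/idP/eqP => [|->]; [exact: word_uniq|exact: isob_refl].
exact: word_F.
Qed.

Lemma Qm_expand x N : isoinv x -> offF x ->
  x N = \sum_(D in reps (msz N)) ip (msz N) x (Pvec K F (wd (Mat D))) * Qm (Mat D) N.
Proof.
move=> ix ox; have [FN|FN] := excluded_middle_informative (F N); last first.
  by rewrite ox // big1 // => D _; rewrite Qm_offF ?mulr0.
rewrite -{1}(ip_bvec N ix) (eq_ip _ (fun _ => erefl _) (fun L => esym (bvec_expand L FN))).
by rewrite ip_sum; apply: eq_bigr => D _; rewrite mulrC.
Qed.

Lemma KM_expand x : KM K F x -> exists b, forall N, x N =
  \sum_(n <- seq.iota 0 b) \sum_(D in reps n) ip n x (Pvec K F (wd (Mat D))) * Qm (Mat D) N.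
Proof.
move=> [ix [ox [b hb]]]; exists b => N.
have zero n : n != msz N ->
    \sum_(D in reps n) ip n x (Pvec K F (wd (Mat D))) * Qm (Mat D) N = 0.
  by move=> ne; apply: big1 => D _; rewrite Qm_homog ?mulr0 // eq_sym.
have [le|lt] := leqP b (msz N).
  rewrite hb // big1_seq // => n /andP[_]; rewrite mem_iota add0n => /= nb.
  by apply: zero; rewrite neq_ltn (leq_trans nb).
rewrite (bigD1_seq (msz N)) ?iota_uniq ?mem_iota //= -Qm_expand // big1 ?addr0 //.
Qed.

(** * Independence, spanning and cofreeness *)

(** Pairing a relation with the [P] of one of its words isolates that coefficient. The index type is
    left open to serve both words of letters and single irreducibles. *)
Lemma Qm_independent (I : eqType) (b : I -> matroid -> K) (W : I -> seq matroid) l :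
  (forall p, p \in l -> word (W p.1) /\ b p.1 =1 Qm (fprod_seq (W p.1))) ->
  {in map fst l &, injective W} -> uniq (map fst l) -> (forall M, lincomb b l M = 0) ->
  forall p, p \in l -> p.2 = 0.
Proof.
move=> hl Winj ul l0 p0 p0l; have [g0 _] := hl _ p0l.
pose n := msz (fprod_seq (W p0.1)).
have : ip n (lincomb b l) (Pvec K F (W p0.1)) = 0.
  by rewrite /ip /clsum big1 // => D _; rewrite l0 mul0r.
rewrite ip_lincomb (bigD1_seq p0) //=; last exact: map_uniq ul.
have ipE p : p \in l -> ip n (b p.1) (Pvec K F (W p0.1)) =
    (isob (fprod_seq (W p.1)) (fprod_seq (W p0.1)))%:R.
  move=> pl; have [g e] := hl _ pl; rewrite (eq_ip _ e (fun _ => erefl _)) ip_Qm_Pvec //.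
  exact: word_F.
rewrite ipE // isob_refl mulr1 big_seq_cond big1 ?addr0 // => p /andP[pl ne].
rewrite ipE //; case: (boolP (isob _ _)) => [i|_]; last by rewrite mulr0.
case/eqP: ne; apply: (uniq_map_inj ul) => //; apply: Winj; rewrite ?map_f //.
by apply: word_uniq i => //; case: (hl _ pl).
Qed.

(** The labelling [g] and the filter [P] let one list serve both bases: all words, or only the
    irreducibles. *)
Definition spanning_list (I : Type) (g : matroid -> I) (P : pred matroid) x b : seq (I * K) :=
  flatten [seq [seq (g (Mat D), ip n x (Pvec K F (wd (Mat D)))) |
                D <- enum (reps n) & P (Mat D)] | n <- seq.iota 0 b].

Lemma lincomb_spanning_list (I : Type) (g : matroid -> I) (P : pred matroid) x b
    (B : I -> matroid -> K) N :
  lincomb B (spanning_list g P x b) N =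
  \sum_(n <- seq.iota 0 b) \sum_(D in reps n | P (Mat D))
     ip n x (Pvec K F (wd (Mat D))) * B (g (Mat D)) N.
Proof.
rewrite /lincomb /spanning_list big_flatten big_map; apply: eq_bigr => n _ /=.
by rewrite big_map big_filter big_enum_cond.
Qed.

Lemma in_spanning_list (I : Type) (g : matroid -> I) (P : pred matroid) x b p :
  List.In p (spanning_list g P x b) ->
  exists M, [/\ F M, isrep M, P M & p.1 = g M].
Proof.
rewrite /spanning_list; elim: (seq.iota 0 b) => //= n s IH pl; case: (List.in_app_or _ _ _ pl) => {pl} [|/IH //].
have : all (fun D => D \in reps n) (enum (reps n)).
  by apply/allP=> D; rewrite mem_enum.
elim: (enum _) => //= D t IHt /andP[/repsP[rD FD] /IHt{}IHt]; case: ifP => //= PD [<-|/IHt //].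
by exists (Mat D).
Qed.

Definition letter := {M : matroid | irrF M}.

Lemma word_letters (w : seq letter) : word (map val w).
Proof. by apply/allP=> M /mapP[x _ ->]; apply: valP. Qed.

Lemma letters_word w : word w -> map val (pmap insub w : seq letter) = w.
Proof. by elim: w => //= M w IH /andP[hM /IH e]; rewrite insubT /= e. Qed.

Lemma cofree_KM : cofree K F.
Proof.
exists letter, (fun w => Qm (fprod_seq (map val w))); split; last first.
  split=> [w N1 N2|w].
    rewrite delta_Qm ?word_letters // size_map; apply: eq_bigr => i _.
    by rewrite map_take map_drop.
  (* Evaluation at [emptyM] is the pairing with the [P] of the empty word. *)
  rewrite /eps.
  have := ip_Qm_Pvec (word_F (word_letters w)) (erefl : word [::]) erefl.
  rewrite ip_bvec; last exact: isoinv_Qm.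
  move=> ->; congr (_%:R); congr nat_of_bool; apply/idP/eqP => [i|].
    by have := word_uniq (word_letters w) (erefl : word [::]) i; case: w {i}.
  by case: w => // _; apply: isob_refl.
split=> [w _|]; first exact: KM_Qm.
split=> [x Kx|l _ nd l0 p pl].
  have [b hb] := KM_expand Kx.
  exists (spanning_list (fun M => pmap insub (wd M)) xpredT x b); split=> // N.
  rewrite lincomb_spanning_list hb; apply: eq_bigr => n _.
  rewrite [RHS]big_andbC /=; apply: eq_big => // D /repsP[_ FD].
  have [g i] := wdP FD; rewrite letters_word //; congr (_ * _).
  exact: Qm_isob.
apply: (@Qm_independent _ _ (map val) l) l0 _ _.
- by move=> q _; split; [exact: word_letters|].
- by move=> u v _ _; apply: inj_map; apply: val_inj.
- exact: NoDup_uniq.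
by apply/InP.
Qed.

(** * Uniqueness of the dual family, and primitive elements *)

(** Only degree [n] contributes, so the truncated pairings are constant from [n.+1] on. *)
Lemma pairing_homog n x y c : homog n y -> pairing_is x y c <-> ip n x y = c.
Proof.
move=> hy; have e k : (n < k)%N -> pair_upto k x y = ip n x y.
  move=> lt; rewrite /pair_upto (bigD1 (Ordinal lt)) //= big1 ?addr0 // => i ne.
  by rewrite /clsum big1 // => D _; rewrite hy ?mulr0 //=; apply: contra ne => /eqP <-; apply/eqP/val_inj.
split=> [[b hb]|<-]; last by exists n.+1 => k; apply: e.
by rewrite -(e (maxn b n.+1)) ?leq_maxr // hb // leq_maxl.
Qed.

Lemma dualQ_Qm : dualQ K F Qm.
Proof.
split=> [M _|M N s FM FN sN]; first exact: KM_Qm.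
have [w [gw iw Pw]] := irrfact_word FN sN.
apply/(pairing_homog _ _ (@Pvec_homog s)).
have e : msz (fprod_seq w) = msz (fprod_seq s).
  by case: sN => _ /isob_msz <-; rewrite (isob_msz iw).
by rewrite (eq_ip _ (fun _ => erefl _) Pw) ip_Qm_Pvec // (isob_congr _ iw).
Qed.

Lemma word_irrfact M : F M -> irrfact M (wd M).
Proof.
move=> FM; have [g i] := wdP FM; split=> // A /InP/(allP g)/irrFP[FA [iA _]].
by split=> //; apply: F_mat.
Qed.

(** By [Qm_expand] an element of K[F] is determined by its pairings with the [P], and [dualQ]
    prescribes these. *)
Lemma dualQ_unique Q M : dualQ K F Q -> F M -> Q M =1 Qm M.
Proof.
move=> dQ FM N.
have coef R : dualQ K F R -> forall D, D \in reps (msz N) ->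
    ip (msz N) (R M) (Pvec K F (wd (Mat D))) = (isob M (Mat D))%:R.
  move=> [_ dR] D /repsP[_ FD]; apply/pairing_homog; last exact: dR (word_irrfact FD).
  by have [_ /isob_msz e] := wdP FD; have h := @Pvec_homog (wd (Mat D)); rewrite -e in h.
have ex R : dualQ K F R -> R M N = \sum_(D in reps (msz N)) (isob M (Mat D))%:R * Qm (Mat D) N.
  move=> dR; have [iR [oR _]] := (proj1 dR) M FM.
  by rewrite (Qm_expand N iR oR); apply: eq_bigr => D Dr; rewrite coef.
by rewrite (ex _ dQ) (ex _ dualQ_Qm).
Qed.

Lemma wd_irr M : irrF M -> wd M = [:: M].
Proof.
move=> iM; have [FM _] := irrFP _ iM; apply: wd_eq; rewrite /= ?iM //.
by rewrite isob_sym; apply: freeprod_idr matroid_emptyM _ => //; apply: F_mat.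
Qed.

Lemma Qm_irr M : irrF M -> Qm M =1 Qm (fprod_seq [:: M]).
Proof. by move=> iM; have [FM _] := irrFP _ iM; apply: Qm_isob; have [_] := wdP FM; rewrite wd_irr. Qed.

(** This identifies the two end terms in the deconcatenation of a letter with those in the
    definition of a primitive element. *)
Lemma Qm_nil : Qm (fprod_seq [::]) =1 bvec K emptyM.
Proof.
move=> N; have [FN|FN] := excluded_middle_informative (F N); last first.
  rewrite Qm_offF // /bvec; case: (boolP (isob _ _)) => // i; case: FN; exact: F_iso F_empty.
have [sN|sN] := eqVneq (msz N) 0%N; last first.
  rewrite (@Qm_homog emptyM) // /bvec; case: (boolP (isob _ _)) => // /isob_msz /= e.
  by rewrite -e in sN.
have i := isob_empty (F_mat FN) sN; rewrite /bvec i.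
rewrite -(isoinv_Qm emptyM i) -(ip_bvec emptyM (isoinv_Qm emptyM)).
by rewrite (@ip_Qm_Pvec _ emptyM [::] F_empty isT erefl) isob_refl.
Qed.

Lemma primitive_Qm M : irrF M -> primitive K F (Qm M).
Proof.
move=> iM; split=> [|N1 N2]; first exact: KM_Qm.
have e : delta (Qm M) N1 N2 = delta (Qm (fprod_seq [:: M])) N1 N2.
  by apply: eq_bigr => D _; rewrite (Qm_irr iM).
rewrite e delta_Qm; last by rewrite /word /= iM.
by rewrite !big_ord_recl big_ord0 addr0 /tens /= !Qm_nil -!(Qm_irr iM).
Qed.

Lemma primitive_coef x M : primitive K F x -> F M -> ~ irreducible M ->
  ip (msz M) x (Pvec K F (wd M)) = 0.
Proof.
move=> [[ix [ox _]] px] FM nM; have [g i] := wdP FM; rewrite (isob_msz i).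
case: (wd M) g i => [|a [|b t]] /=.
(* Empty word: primitivity at the pair of empty matroids reads c = c + c for the value c of [x] at
   [emptyM]. *)
- move=> _ _; rewrite (ip_bvec emptyM ix).
  have := px emptyM emptyM; rewrite deltaE //=.
  rewrite (eq_ip _ (fun _ => erefl _) (mul_bvec0 (isoinv_bvec emptyM) (Pvec_offF [::]))).
  rewrite (ip_bvec emptyM ix) /tens /bvec isob_refl mul1r mulr1 => /eqP.
  by rewrite -subr_eq0 opprD addNKr oppr_eq0 => /eqP.
- rewrite andbT => /irrFP[Fa [ia _]] i; case: nM; apply: irreducible_isob ia.
  by rewrite isob_sym; apply: isob_trans i _; apply: freeprod_idr matroid_emptyM _ => //; apply: F_mat.
(* With two letters or more, [P] is a product of homogeneous factors of positive degree, and there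
   the coproduct of a primitive element vanishes. *)
move=> /andP[/irrFP[_ [[a0 _] _]] /andP[/irrFP[_ [[b0 _] _]] _]] _.
have hb := @Pvec_homog (b :: t).
rewrite (@ip_mul (msz a) (msz (fprod_seq (b :: t))) x (bvec K a) (Pvec K F (b :: t))) //;
  [|exact: isoinv_bvec|exact: isoinv_Pvec|exact: bvec_homog].
rewrite /clsum big1 // => D _; rewrite big1 ?mulr0 // => E _.
rewrite px /tens /bvec; case: (boolP (isob emptyM (Mat D))) => [/isob_msz /= e|_].
  by rewrite -e in a0.
case: (boolP (isob emptyM (Mat E))) => [/isob_msz /= e|_].
  by exfalso; move: b0 e; case: (msz b).
by rewrite mul0r mulr0 addr0 mulr0.
Qed.

Lemma primitive_basis Q : dualQ K F Q ->
  is_basis (fun M => F M /\ irreducible M /\ isrep M) (primitive K F) Q.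
Proof.
move=> dQ; have QE M : F M -> Q M =1 Qm M by apply: dualQ_unique.
split=> [M hM|].
  have FM : F M by case: hM.
  have [KQ pQ] := primitive_Qm (introT (irrFP M) hM).
  split=> [|N1 N2]; first exact: (proj1 dQ).
  rewrite /tens !(QE M FM) -[RHS]pQ.
  by apply: eq_bigr => D _; rewrite QE.
split=> [x px|l hl nd l0 p pl].
  have [b hb] := KM_expand (proj1 px).
  exists (spanning_list id irrF x b); split=> [p /in_spanning_list[M [_ _ /irrFP h ->]] //|N].
  rewrite lincomb_spanning_list hb; apply: eq_bigr => n _.
  rewrite (bigID (fun D => irrF (Mat D))) /= [X in _ + X]big1 ?addr0 => [|D /andP[/repsP[rD FD] nD]].
    by apply: eq_bigr => D /andP[/repsP[_ FD] _]; rewrite QE.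
  rewrite (@primitive_coef x (Mat D)) ?mul0r // => iD.
  by move/negP: nD; apply; apply/irrFP.
apply: (@Qm_independent _ Q (fun M => [:: M]) l) l0 _ _.
- move=> q /InP/hl hq; have iq := introT (irrFP q.1) hq.
  split; first by rewrite /word /= iq.
  by move=> N; rewrite (QE _ (proj1 hq)); apply: Qm_irr.
- by move=> u v _ _ [].
- exact: NoDup_uniq.
by apply/InP.
Qed.

End Algebra.

(** * From a family to its closure under isomorphism *)

Lemma isoclos_minor fam :
  (forall M, fam M -> matroidb M) ->
  (forall M (A : {set 'I_(msz M)}), fam M ->
      isoclos fam (restr M A) /\ isoclos fam (contr M A)) ->
  forall M A, isoclos fam M -> isoclos fam (restr M A) /\ isoclos fam (contr M A).
Proof.
move=> fmat fmin M A [N [fN iNM]]; have mN := fmat _ fN; have mM := isob_matroid iNM mN.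
have iMN : isob M N by rewrite isob_sym.
have [f v] := isob_minor iMN; have [[B [fB iB]] [C [fC iC]]] := fmin N (f @: A) fN.
split; [exists B|exists C]; split=> //.
  by apply: isob_trans iB _; rewrite isob_sym; apply: restr_isob.
by apply: isob_trans iC _; rewrite isob_sym; apply: contr_isob.
Qed.

Theorem theorem7p10 (K : fieldType) (charK0 : [pchar K] =i pred0)
  (fam : matroid -> Prop)
  (fam_matroids : forall M, fam M -> matroidb M)
  (fam_nonempty : exists M, fam M)
  (fam_minors : forall M (A : {set 'I_(msz M)}), fam M ->
      isoclos fam (restr M A) /\ isoclos fam (contr M A))
  (fam_fprod : forall M N, fam M -> fam N -> isoclos fam (freeprod M N)) :
  cofree K (isoclos fam) /\
  (exists Q, dualQ K (isoclos fam) Q) /\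
  (forall Q : matroid -> matroid -> K, dualQ K (isoclos fam) Q ->
     is_basis (fun M => isoclos fam M /\ irreducible M /\ isrep M)
              (primitive K (isoclos fam)) Q).
Proof.
pose F := isoclos fam.
have F_iso M N : isob M N -> F M -> F N.
  by move=> iMN [A [fA iA]]; exists A; split=> //; apply: isob_trans iA iMN.
have F_mat M : F M -> matroidb M by move=> [A [fA iA]]; apply: isob_matroid iA (fam_matroids _ fA).
have F_min := isoclos_minor fam_matroids fam_minors.
have F_restr M A : F M -> F (restr M A) by move=> FM; case: (F_min M A FM).
have F_contr M A : F M -> F (contr M A) by move=> FM; case: (F_min M A FM).
(* The empty matroid is a member's restriction to the empty set, which is where some member must
   exist. *)
have F_empty : F emptyM.
  have [M fM] := fam_nonempty.
  have FM : F M by exists M; split=> //; apply: isob_refl.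
  have FR := F_restr M set0 FM; apply: F_iso (FR).
  by rewrite isob_sym; apply: isob_empty (F_mat _ FR) _; rewrite /= cards0.
have F_prod M N : F M -> F N -> F (freeprod M N).
  move=> [A [fA iA]] [B [fB iB]]; apply: F_iso (fam_fprod _ _ fA fB).
  by apply: freeprod_isob; rewrite ?fam_matroids.
split; first exact: cofree_KM.
split; first by exists (Qm K F); apply: dualQ_Qm.
by move=> Q; apply: primitive_basis.
Qed.
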